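(* Let $T>0$ and let $X=(X_t)_{t\in[0,T]}$ be a stochastic process with $X\in C^{\alpha}([0,T])$ for some $\alpha>\frac12$, satisfying Assumption (D) (stated in the context). Let $f:\mathbb{R}\to\mathbb{R}$ be a function with left-sided derivative $f'_-$ such that $f'_-\in BV^{loc}$ and $f(x)=\int_0^x f'_-(y)\,\mathrm{d}y$ for all $x\in\mathbb{R}$. Then, for $t\in[0,T]$, almost surely $$f(X_t)=f(X_0)+\int_0^t f'_-(X_s)\,\mathrm{d}X_s,$$ where the integral is a generalized Lebesgue--Stieltjes integral.
   Context: $C^{\alpha}([0,T])$ is the space of Hölder continuous functions of order $\alpha$ on $[0,T]$; for a stochastic process $X$, $X\in C^\alpha([0,T])$ means that its sample paths belong to this space almost surely. $BV^{loc}$ is the space of functions $g:\mathbb{R}\to\mathbb{R}$ that are of bounded variation (bounded $1$-variation) over every compact subset of $\mathbb{R}$. Assumption (D) on a real-valued process $X=(X_t)_{t\in[0,T]}$: for almost every $t\in[0,T]$ the random variable $X_t$ has a density $p_t(y)$ (with respect to Lebesgue measure), and there exists $g\in L^1([0,T])$ such that $\sup_y p_t(y)\le g(t)$ for almost every $t\in[0,T]$. Fractional Besov spaces, $0<\beta<1$: $W_1^\beta=W_1^\beta([0,T])$ is the space of measurable $f:[0,T]\to\mathbb{R}$ with $$\|f\|_{1,\beta}=\sup_{0\le s<t\le T}\left(\frac{|f(t)-f(s)|}{(t-s)^\beta}+\int_s^t\frac{|f(u)-f(s)|}{(u-s)^{1+\beta}}\,\mathrm{d}u\right)<\infty,$$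 and $W_2^\beta=W_2^\beta([0,T])$ is the space of measurable $f:[0,T]\to\mathbb{R}$ with $$\|f\|_{2,\beta}=\int_0^T\frac{|f(s)|}{s^\beta}\,\mathrm{d}s+\int_0^T\int_0^s\frac{|f(u)-f(s)|}{(s-u)^{1+\beta}}\,\mathrm{d}u\,\mathrm{d}s<\infty.$$ Generalized Lebesgue--Stieltjes integral: $\int_0^t f\,\mathrm{d}g$ (for $t\in(0,T]$; for $t=0$ it is $0$) exists in the generalized Lebesgue--Stieltjes sense if there is $\beta\in(0,1)$ with $f\in W_2^\beta$ and $g\in W_1^{1-\beta}$; it is then defined as the Lebesgue integral $$\int_0^t f(s)\,\mathrm{d}g(s)=-\int_0^t (D^\beta_{0+}f)(s)\,(D^{1-\beta}_{t-}g_{t-})(s)\,\mathrm{d}s,$$ where $$(D^\beta_{0+}f)(s)=\frac{1}{\Gamma(1-\beta)}\left(\frac{f(s)}{s^\beta}+\beta\int_0^s\frac{f(s)-f(u)}{(s-u)^{\beta+1}}\,\mathrm{d}u\right),$$ $$(D^{1-\beta}_{t-}g_{t-})(s)=\frac{1}{\Gamma(\beta)}\left(\frac{g(s)-g(t)}{(t-s)^{1-\beta}}+(1-\beta)\int_s^t\frac{g(s)-g(u)}{(u-s)^{2-\beta}}\,\mathrm{d}u\right),$$ and the value does not depend on the choice of such $\beta$. *)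

(* Defs.v *)
From HB Require Import structures.
From mathcomp Require Import all_boot all_order all_algebra.
From mathcomp Require Import all_classical all_reals all_analysis.
Import Order.TTheory GRing.Theory Num.Theory.
Import numFieldNormedType.Exports.

Set Implicit Arguments.
Unset Strict Implicit.
Unset Printing Implicit Defensive.

Local Open Scope classical_set_scope.
Local Open Scope ring_scope.

Section functions.
Context {R : realType}.
Notation mu := (@lebesgue_measure R).
Implicit Types (f g x : R -> R) (alpha beta T a b t : R).

(* Functions on [0, T] are represented by functions on R of which only the
   values on [0, T] are used. *)

Definition holder alpha T x :=
  exists C : R, forall s t, s \in `[0, T] -> t \in `[0, T] ->
    `|x t - x s| <= C * `|t - s| `^ alpha.

(* Every compact subset of R lies in some [a, b], and the variation over a
   subset is at most the variation over [a, b]. *)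
Definition locally_bounded_variation f :=
  forall a b, bounded_variation a b f.

Definition left_quotient f (y h : R) : R := (f (y + h) - f y) / h.

Definition left_derivable f :=
  forall y, cvg (left_quotient f y h @[h --> 0^'-]).

(* Meaningful where the limit exists, as for every use of lim. *)
Definition left_derivative f (y : R) : R :=
  lim (left_quotient f y h @[h --> 0^'-]).

Definition oriented_integral f a b : R :=
  if a <= b then \int[mu]_(y in `[a, b]) f y
  else - \int[mu]_(y in `[b, a]) f y.

(* The Besov norms take values in [0, +oo]. *)
Definition besov1_norm beta T f : \bar R :=
  ereal_sup [set ((`|f st.2 - f st.1| / (st.2 - st.1) `^ beta)%:E
      + \int[mu]_(u in `[st.1, st.2])
          (`|f u - f st.1| / (u - st.1) `^ (1 + beta))%:E)%E
    | st in [set st : R * R | 0 <= st.1 /\ st.1 < st.2 /\ st.2 <= T]].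

Definition besov1 beta T f :=
  measurable_fun `[0, T] f /\ (besov1_norm beta T f < +oo)%E.

Definition besov2_norm beta T f : \bar R :=
  (\int[mu]_(s in `[0%R, T]) (`|f s| / s `^ beta)%:E
   + \int[mu]_(s in `[0%R, T]) \int[mu]_(u in `[0%R, s])
        (`|f u - f s| / (s - u) `^ (1 + beta))%:E)%E.

Definition besov2 beta T f :=
  measurable_fun `[0, T] f /\ (besov2_norm beta T f < +oo)%E.

Definition Gamma (a : R) : R :=
  \int[mu]_(x in `]0, +oo[) (x `^ (a - 1) * expR (- x)).

(* D^beta_{0+} f *)
Definition frac_deriv_left beta f (s : R) : R :=
  (Gamma (1 - beta))^-1 *
  (f s / s `^ beta +
   beta * \int[mu]_(u in `[0, s]) ((f s - f u) / (s - u) `^ (beta + 1))).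

(* D^{1-beta}_{t-} g_{t-} *)
Definition frac_deriv_right beta t g (s : R) : R :=
  (Gamma beta)^-1 *
  ((g s - g t) / (t - s) `^ (1 - beta) +
   (1 - beta) * \int[mu]_(u in `[s, t]) ((g s - g u) / (u - s) `^ (2 - beta))).

(* "The integral of f against g over [0, t] exists in the generalized
   Lebesgue-Stieltjes sense and equals v".  The value does not depend on the
   admissible beta, and it is 0 for t = 0, [0, 0] being a null set. *)
Definition is_gls_integral T f g t (v : R) :=
  exists2 beta, 0 < beta < 1 &
    [/\ besov2 beta T f, besov1 (1 - beta) T g &
        v = - \int[mu]_(s in `[0, t])
                (frac_deriv_left beta f s * frac_deriv_right beta t g s)].

End functions.

Section processes.
Context d (Omega : measurableType d) (R : realType) (P : probability Omega R).
Notation mu := (@lebesgue_measure R).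

Definition is_density (Y : {RV P >-> R}) (p : R -> R) :=
  [/\ measurable_fun setT p, forall y, 0 <= p y &
      forall A : set R, measurable A ->
        distribution P Y A = (\int[mu]_(y in A) (p y)%:E)%E].

Definition assumption_D (T : R) (X : R -> {RV P >-> R}) :=
  exists p : R -> R -> R,
    {ae mu, forall t, t \in `[0, T] -> is_density (X t) (p t)} /\
    exists2 g : R -> R, mu.-integrable `[0, T] (EFin \o g) &
      {ae mu, forall t, t \in `[0, T] ->
        (ereal_sup (range (fun y => (p t y)%:E)) <= (g t)%:E)%E}.

End processes.

(* Main.v *)
Require Import Defs.
From HB Require Import structures.
From mathcomp Require Import all_boot all_order all_algebra.
From mathcomp Require Import all_classical all_reals all_analysis.
From mathcomp Require Import measurable_realfun.
From mathcomp Require Import ring lra.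
Import Order.TTheory GRing.Theory Num.Theory.
Import numFieldNormedType.Exports.

(** Write [h] for the left derivative of [f].  Since [alpha > 1/2], the exponent
    [beta = 1/2] is admissible, and the formula is first proved for a single
    path [x] and then shown to apply to almost every path of the process.

    The first ingredient is an evaluation of the fractional pairing
    [int_0^t D^{1/2}_{0+} Phi * D^{1/2}_{t-} g_{t-}].  For a ramp
    [g = min(., b)] the right derivative is a multiple of the square root of
    [(b - s)_+] ([weyl_ramp]), so the pairing is an Abel transform of the
    Marchaud derivative of [Phi].  Abel's integral inverts that derivative
    ([marchaud_abel]) and the pairing is [- int_0^b Phi].  By linearity the
    integral of [Phi] against a piecewise linear [g] is the sum, over the
    cells, of the slope of [g] times the integral of [Phi].  The interpolations
    of a Hölder path [x] on finer and finer grids are Hölder uniformly in the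
    grid, so their right derivatives are bounded and converge to that of [x];
    by dominated convergence the integral against [x] is the limit of the sums
    [riemann_sum] of slopes times cell integrals ([cvg_riemann_sum]).

    The second ingredient compares these sums, for [Phi = h o x], with
    [f(x_t) - f(x_0)].  On one cell of length [delta] the increment of [f] is an
    average of values of [h] between two values of [x], so it differs from the
    corresponding summand by at most a multiple of [delta^{alpha - 1}] times the
    integral over the cell of the oscillation of [h] in a window of radius
    [N delta^alpha] around [x_s] ([chain_rule_cell]).  This oscillation is
    measured by a variation function [V] of [h].  Everything therefore
    rests on the finiteness of the integral over [s] of the energy
    [int_0^T (V(x_s + N r^alpha) - V(x_s - N r^alpha)) r^{-3/2} dr]: it
    bounds the Besov seminorm of [h o x] ([gagliardo_fin]), which is what the
    existence of the integral requires, and since the oscillation increases with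
    the window it also shows that the oscillation at scale [delta] has an
    integral of order [delta^{1/2}] ([integral_osc_window]).  The total error is
    then of order [delta^{alpha - 1/2}] and vanishes ([gls_chain_rule]).

    Finally, the energy is almost surely finite because it has finite
    expectation: by the layer-cake formula and the bound [g(s)] on the density of
    [X_s], the mean of [V(X_s + r) - V(X_s - r)] is at most
    [4 r g(s) sup V] ([expected_increment]), and [r^{alpha - 3/2}] is integrable at
    [0].  Tonelli's theorem needs joint measurability in time and
    chance, which a version of the process with Hölder paths provides
    ([holder_version]). *)

Set Implicit Arguments.
Unset Strict Implicit.
Unset Printing Implicit Defensive.

Local Open Scope classical_set_scope.
Local Open Scope ring_scope.

(** * Integration on the real line *)

Section invariance.
Context {R : realType}.
Notation mu := (@lebesgue_measure R).

Lemma pushforward_addr (c : R) (A : set R) : measurable A ->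
  pushforward mu (fun u : measurableTypeR R => (u + c)%R : measurableTypeR R) A = mu A.
Proof.
move=> mA; apply/esym.
pose f : measurableTypeR R -> measurableTypeR R := fun u => u + c.
have mf : measurable_fun setT f by exact: measurable_funD.
pose F : {mfun measurableTypeR R >-> measurableTypeR R} :=
  HB.pack f (isMeasurableFun.Build _ _ _ _ f mf).
apply: (@lebesgue_measure_unique R (pushforward mu F)) => // _ [[a b]] _ <-.
rewrite /= /pushforward.
have -> : (fun u : R => u + c) @^-1` `]a, b]%classic = `]a - c, b - c]%classic.
  apply/seteqP; split => x /=; rewrite !in_itv/=; lra.
rewrite !lebesgue_measure_itv/= !lte_fin ltrD2r.
by rewrite -!EFinB opprB addrA subrK.
Qed.

Lemma ge0_integral_addr (c : R) (D : set R) (f : R -> \bar R) :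
  measurable D -> measurable_fun D f -> (forall y, D y -> (0 <= f y)%E) ->
  (\int[mu]_(u in (fun u => (u + c)%R) @^-1` D) f (u + c)%R =
   \int[mu]_(r in D) f r)%E.
Proof.
move=> mD mf f0.
have := @ge0_integral_pushforward _ _ (measurableTypeR R) (measurableTypeR R) R
  (fun u => u + c) (measurable_funD (@measurable_id _ _ _) (measurable_cst c)) mu D f mD mf
  (fun x xD => f0 x (set_mem xD)).
move=> /= <-.
apply: eq_measure_integral => /= [|_ A mA _].
  exact: measurable_funD.
exact: pushforward_addr.
Qed.

Lemma ge0_integral_oppr (D : set R) (f : R -> \bar R) :
  measurable D -> measurable_fun D f -> (forall y, D y -> (0 <= f y)%E) ->
  (\int[mu]_(u in -%R @^-1` D) f (- u)%R = \int[mu]_(r in D) f r)%E.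
Proof.
move=> mD mf f0.
have := @ge0_integral_pushforward _ _ (measurableTypeR R) (measurableTypeR R) R
  -%R (@oppr_measurable R setT) mu D f mD mf
  (fun x xD => f0 x (set_mem xD)).
move=> /= <-.
apply: eq_measure_integral => //= A mA AD; exact: lebesgue_measureN.
Qed.

Lemma ge0_integral_shift (s t : R) (f : R -> \bar R) :
  measurable_fun setT f -> (forall y, (0 <= f y)%E) ->
  (\int[mu]_(u in `[s, t]) f (u - s)%R = \int[mu]_(r in `[0%R, (t - s)%R]) f r)%E.
Proof.
move=> mf f0; rewrite -(@ge0_integral_addr (- s) `[0, t - s])//; last exact: measurable_funTS.
congr (integral _ _ _); apply/seteqP; split => x /=; rewrite !in_itv/=; lra.
Qed.

Lemma ge0_integral_reflect (s : R) (f : R -> \bar R) :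
  measurable_fun setT f -> (forall y, (0 <= f y)%E) ->
  (\int[mu]_(u in `[0%R, s]) f (s - u)%R = \int[mu]_(r in `[0%R, s]) f r)%E.
Proof.
move=> mf f0.
rewrite -(@ge0_integral_oppr `[0, s] f)//; [|exact: measurable_funTS].
rewrite -(@ge0_integral_addr (- s) _ (fun u => f (- u)%R))//; [|..].
- under [RHS]eq_integral do rewrite opprB.
  congr (integral _ _ _); apply/seteqP; split => x /=; rewrite !in_itv/=; lra.
- by rewrite -[X in measurable X]setTI; apply: oppr_measurable.
- by apply: measurable_funTS; apply: measurableT_comp.
Qed.

(** Monotone convergence. It gives access to integrands whose primitive is regular
    only away from the left endpoint, such as negative powers of [r] at [0]. *)
Lemma cvg_integral_left_open (a : R) (b : itv_bound R) (u : nat -> R) (f : R -> \bar R) :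
  (forall n, a < u n) -> nonincreasing_seq u -> u @ \oo --> a ->
  measurable_fun [set` Interval (BRight a) b] f ->
  (forall x, x \in Interval (BRight a) b -> (0 <= f x)%E) ->
  (\int[mu]_(x in [set` Interval (BLeft (u n)) b]) f x @[n --> \oo]
   --> \int[mu]_(x in [set` Interval (BRight a) b]) f x)%E.
Proof.
move=> au niu ua mf f0.
have E : \bigcup_n [set` Interval (BLeft (u n)) b] = [set` Interval (BRight a) b].
  apply/seteqP; split => [x [n _] /=|x /=].
    rewrite !itv_boundlr => /andP[h ->]; rewrite andbT.
    move: h; rewrite !bnd_simp; exact: lt_le_trans.
  rewrite itv_boundlr => /andP[]; rewrite bnd_simp => ax xb.
  have [N _ /(_ N (leqnn N))/= uN] := cvgr_lt a ua x ax.
  by exists N => //=; rewrite itv_boundlr xb andbT bnd_simp ltW.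
rewrite -E; apply: ge0_nondecreasing_set_cvg_integral => //.
- move=> m n mn; apply/subsetPset => x /=; rewrite !itv_boundlr => /andP[+ ->].
  by rewrite !bnd_simp andbT; apply: le_trans; exact: niu.
- by move=> n; apply: measurable_funS mf => //; rewrite -E => x xn; exists n.
- by move=> n x h; apply: f0; have : (\bigcup_n [set` Interval (BLeft (u n)) b]) x; [exists n|rewrite E].
Qed.

Lemma nonincreasing_harmonic : nonincreasing_seq (@harmonic R).
Proof. by move=> m n mn; rewrite /harmonic lef_pV2 ?posrE// ler_nat. Qed.

Lemma FTC2 (f F : R -> R) (a b : R) : a <= b ->
  {within `[a, b], continuous f} -> {within `[a, b], continuous F} ->
  (forall x, a < x < b -> is_derive x 1 F (f x)) ->
  (\int[mu]_(x in `[a, b]) (f x)%:E = (F b - F a)%:E)%E.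
Proof.
rewrite le_eqVlt => /predU1P[<- _ _ _|ab cf cF dF].
  by rewrite set_itv1 integral_set1 subrr.
rewrite EFinB; apply: continuous_FTC2 => //.
  have [_ c1 c2] := (continuous_within_itvP F ab).1 cF.
  split => // x xab; have := dF x; rewrite in_itv/= in xab.
  by move=> /(_ xab) [].
move=> x xab; rewrite in_itv/= in xab; have [h1 h2] := dF x xab.
by rewrite derive1E h2.
Qed.

Lemma continuous_powR_gt0 (p x : R) : 0 < x -> {for x, continuous (fun y : R => y `^ p)}.
Proof.
move=> x0; apply: differentiable_continuous; apply/derivable1_diffP.
by apply: derivable_powR; rewrite in_itv/= andbT.
Qed.

Lemma integral_powR (g a : R) : 0 < g -> 0 <= a ->
  (\int[mu]_(r in `[0%R, a]) (r `^ (g - 1))%:E = (a `^ g / g)%:E)%E.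
Proof.
move=> g0; rewrite le_eqVlt => /predU1P[<-|a0].
  by rewrite set_itv1 integral_set1 powR0 ?gt_eqF// mul0r.
have mp : measurable_fun [set: R] (fun r => (r `^ (g - 1))%:E).
  by apply/measurable_EFinP; exact: measurable_powR.
rewrite -integral_itv_obnd_cbnd; last exact: measurable_funTS.
have h := @cvg_integral_left_open 0 (BRight a) harmonic (fun r => (r `^ (g - 1))%:E)
  harmonic_gt0 nonincreasing_harmonic cvg_harmonic.
have {}h := h (measurable_funTS mp) (fun x _ => powR_ge0 x (g - 1)).
apply: (cvg_unique _ h) => //.
apply: cvg_trans (_ : ((a `^ g - (n.+1%:R^-1) `^ g) / g)%:E @[n --> \oo] --> _).
  apply: near_eq_cvg; near=> n.
  have na : n.+1%:R^-1 < a.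
    near: n; exact: near_infty_natSinv_lt (PosNum a0).
  have n0 : 0 < n.+1%:R^-1 :> R by [].
  rewrite /harmonic.
  have -> : ((a `^ g - n.+1%:R^-1 `^ g) / g) = a `^ g / g - n.+1%:R^-1 `^ g / g.
    by rewrite -mulrBl.
  apply/esym/(@FTC2 (fun r => r `^ (g - 1)) (fun r => r `^ g / g)); first exact: ltW.
  - apply: continuous_in_subspaceT => x; rewrite inE/= in_itv/= => /andP[nx _].
    by apply: continuous_powR_gt0; exact: lt_le_trans nx.
  - apply: continuous_in_subspaceT => x; rewrite inE/= in_itv/= => /andP[nx _].
    by apply: cvgM; [apply: continuous_powR_gt0; exact: lt_le_trans nx|exact: cvg_cst].
  - move=> x /andP[nx _].
    have x0 : 0 < x by exact: lt_trans nx.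
    have := is_derive1_powR g x0 => h1.
    have -> : x `^ (g - 1) = g^-1 *: (g * x `^ (g - 1)).
      by rewrite /GRing.scale/= mulKf// gt_eqF.
    under eq_fun do rewrite mulrC.
    exact: is_deriveZ.
apply: cvg_EFin; first by near=> n.
have : ((a `^ g - (n.+1%:R^-1) `^ g) / g) @[n --> \oo] --> (a `^ g - 0) / g.
  apply: cvgMr_tmp; apply: cvgB; first exact: cvg_cst.
  apply: ((cvg_at_rightP _ _ _).1 (powR_cvg0 g0)); split => //.
  exact: cvg_harmonic.
by rewrite subr0.
Unshelve. all: end_near. Qed.

Lemma Rintegral_dominated_cvg d (S : measurableType d) (m : {measure set S -> \bar R})
    (D : set S) (f_ : nat -> S -> R) (f g : S -> R) :
  measurable D -> (forall n, measurable_fun D (f_ n)) -> measurable_fun D f ->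
  {ae m, forall x, D x -> f_ ^~ x @ \oo --> f x} ->
  m.-integrable D (EFin \o g) ->
  (forall n x, D x -> `|f_ n x| <= g x) ->
  m.-integrable D (EFin \o f) /\
  \int[m]_(x in D) f_ n x @[n --> \oo] --> \int[m]_(x in D) f x.
Proof.
move=> mD mf_ mf ff ig fg.
have [] := @dominated_convergence _ _ _ m D mD (fun n => EFin \o f_ n) (EFin \o f) (EFin \o g).
- by move=> n; apply/measurable_EFinP.
- exact/measurable_EFinP.
- apply: filterS ff => x h Dx; apply: cvg_EFin; last exact: h.
  by near=> n.
- by [].
- by apply: aeW => x n Dx /=; rewrite lee_fin fg.
move=> i _ h; split => //.
apply: (@fine_cvg R _ _ _ (fun n => \int[m]_(x in D) (f_ n x)%:E)%E).
rewrite /Rintegral fineK //; exact: integrable_fin_num.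
Unshelve. all: end_near. Qed.

Lemma le_integrable_EFin d (S : measurableType d) (m : {measure set S -> \bar R})
    (D : set S) (f g : S -> R) : measurable D -> measurable_fun D f ->
  (forall x, D x -> `|f x| <= g x) ->
  m.-integrable D (EFin \o g) -> m.-integrable D (EFin \o f).
Proof.
move=> mD mf fg; apply: le_integrable => //; first exact/measurable_EFinP.
by move=> x Dx /=; rewrite lee_fin (le_trans (fg _ Dx))// ler_norm.
Qed.

Lemma ae_eq_integrable d (S : measurableType d) (m : {measure set S -> \bar R})
    (D : set S) (f g : S -> \bar R) : measurable D -> ae_eq m D f g ->
  measurable_fun D g -> m.-integrable D f -> m.-integrable D g.
Proof.
move=> mD fg mg /integrableP[mf foo]; apply/integrableP; split => //.
rewrite -(@ae_eq_integral _ _ _ m D _ (abse \o f)) //.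
- exact: measurableT_comp.
- exact: measurableT_comp.
- by apply: filterS fg => x + Dx => /(_ Dx) /= ->.
Qed.

Section Rfubini.
Context d1 d2 (T1 : measurableType d1) (T2 : measurableType d2).
Variables (m1 : {sigma_finite_measure set T1 -> \bar R})
  (m2 : {sigma_finite_measure set T2 -> \bar R}) (F : T1 * T2 -> R).
Hypothesis iF : (m1 \x m2)%E.-integrable setT (EFin \o F).

Lemma Rintegral_section1 :
  {ae m1, forall x, fubini_F m2 (EFin \o F) x = (\int[m2]_y F (x, y))%:E}.
Proof.
have := ae_integrable1 iF; apply: filterS => x h.
rewrite /Rintegral fineK//; exact: integrable_fin_num.
Qed.

Lemma Rintegral_section2 :
  {ae m2, forall y, fubini_G m1 (EFin \o F) y = (\int[m1]_x F (x, y))%:E}.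
Proof.
have := ae_integrable2 iF; apply: filterS => x h.
rewrite /Rintegral fineK//; exact: integrable_fin_num.
Qed.

Lemma measurable_Rfubini1 : measurable_fun setT (fun x => \int[m2]_y F (x, y)).
Proof.
by apply: measurableT_comp (measurable_fubini_F iF); exact: fine_measurable.
Qed.

Lemma measurable_Rfubini2 : measurable_fun setT (fun y => \int[m1]_x F (x, y)).
Proof.
by apply: measurableT_comp (measurable_fubini_G iF); exact: fine_measurable.
Qed.

Lemma Rfubini1 : m1.-integrable setT (EFin \o (fun x => \int[m2]_y F (x, y))) /\
  \int[m1]_x \int[m2]_y F (x, y) = \int[(m1 \x m2)%E]_z F z.
Proof.
have h : ae_eq m1 setT (fubini_F m2 (EFin \o F)) (fun x => (\int[m2]_y F (x, y))%:E).
  by apply: filterS Rintegral_section1 => x hx _.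
have mE : measurable_fun setT (fun x => (\int[m2]_y F (x, y))%:E).
  exact/measurable_EFinP/measurable_Rfubini1.
split; last first.
  rewrite /Rintegral; congr fine; rewrite -integral12_prod_meas1//.
  apply/esym/ae_eq_integral => //.
  exact: measurable_fubini_F iF.
apply: ae_eq_integrable h _ _ => //; exact: integrable_fubini_F iF.
Qed.

Lemma Rfubini2 : m2.-integrable setT (EFin \o (fun y => \int[m1]_x F (x, y))) /\
  \int[m2]_y \int[m1]_x F (x, y) = \int[(m1 \x m2)%E]_z F z.
Proof.
have mF : measurable_fun setT (EFin \o F) := measurable_int _ iF.
have h : ae_eq m2 setT (fubini_G m1 (EFin \o F)) (fun y => (\int[m1]_x F (x, y))%:E).
  by apply: filterS Rintegral_section2 => x hx _.
have mE : measurable_fun setT (fun y => (\int[m1]_x F (x, y))%:E).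
  exact/measurable_EFinP/measurable_Rfubini2.
split; last first.
  rewrite /Rintegral; congr fine; rewrite -integral21_prod_meas1//.
  apply/esym/ae_eq_integral => //.
  exact: measurable_fubini_G iF.
apply: ae_eq_integrable h _ _ => //.
apply/integrableP; split; first exact: measurable_fubini_G iF.
apply: le_lt_trans ((integrable21ltyP _ _ mF).1 iF).
apply: ge0_le_integral => //.
- by apply: measurableT_comp => //; exact: measurable_fubini_G iF.
- apply: (measurable_fun_fubini_tonelli_G (abse \o (EFin \o F))); last first.
    by move=> y; exact: abse_ge0.
  by apply: measurableT_comp.
- move=> y _; apply: le_abse_integral => //.
  exact: measurableT_comp (pair2_measurable y).
Qed.
End Rfubini.

(** The substitution [x = y^2] turns this integral into the Gaussian integral. The
    derivative of the square root blows up at [0], so the substitution is made on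
    [[a, +oo[] and [a] then tends to [0]. *)
Lemma Gamma_half : Gamma (2^-1 : R) = Num.sqrt pi.
Proof.
pose F (x : R) := x `^ 2^-1.
pose G (x : R) := 2 * gauss_fun x.
have dF (x : R) : 0 < x -> F^`()%classic x = 2^-1 * x `^ (2^-1 - 1).
  by move=> x0; rewrite powR_derive1// in_itv/= andbT.
have cdF (x : R) : 0 < x -> F^`()%classic y @[y --> x] --> 2^-1 * x `^ (2^-1 - 1).
  move=> x0; apply: (@cvg_trans _ ((2^-1 * y `^ (2^-1 - 1)) @[y --> x])).
    apply: near_eq_cvg; near=> y; rewrite dF//.
    near: y; exact: lt_nbhsr x0.
  exact: (cvgMl_tmp (continuous_powR_gt0 (p := 2^-1 - 1) x0)).
have dFneg (x : R) : 0 < x -> F^`()%classic x = 2^-1 * (F x)^-1.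
  by move=> x0; rewrite dF// /F -powRN; congr (_ * _ `^ _); field.
have mG : measurable_fun setT (fun x => (G x)%:E).
  by apply/measurable_EFinP; apply: measurable_funM => //; exact: measurable_gauss_fun.
have G0 x : 0 <= G x by rewrite mulr_ge0// gauss_fun_ge0.
have Fy : F x @[x --> +oo] --> +oo.
  apply/cvgryPge => A; near=> x.
  have x0 : 0 < x by near: x; exact: nbhs_pinfty_gt.
  rewrite /F powR12_sqrt ?ltW//.
  have [A0|A0] := leP A 0; first by rewrite (le_lt_trans A0)// sqrtr_gt0.
  rewrite -(ltr_pXn2r (ltn0Sn 1)) ?nnegrE ?sqrtr_ge0 ?ltW// sqr_sqrtr ?ltW//.
  by near: x; apply: nbhs_pinfty_gt; exact: num_real.
have step (a : R) : 0 < a ->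
   (\int[mu]_(x in `[F a, +oo[) (G x)%:E =
    \int[mu]_(x in `[a, +oo[) (x `^ (2^-1 - 1) * expR (- x))%:E)%E.
  move=> a0.
  have ax x : x \in `]a, +oo[ -> 0 < x.
    by rewrite in_itv/= andbT; exact: lt_trans.
  rewrite (@increasing_ge0_integration_by_substitutiony R F G a).
  - apply: eq_integral => x; rewrite inE/= in_itv/= andbT => xa.
    have x0 : 0 < x by exact: lt_le_trans xa.
    have -> : ((G \o F) * F^`()%classic) x = G (F x) * F^`()%classic x by [].
    rewrite dF// /G /gauss_fun.
    have -> : F x ^+ 2 = x by rewrite /F powR12_sqrt 1?ltW// sqr_sqrtr 1?ltW.
    by congr EFin; field.
  - move=> x y; rewrite !in_itv/= !andbT => xa ya xy.
    apply: gt0_ltr_powR => //; rewrite ?invr_gt0// nnegrE ltW//; apply: lt_le_trans; by [exact: a0|].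
  - move=> x xa.
    by rewrite /continuous_at dF ?ax//; apply: cdF; exact: ax.
  - apply/cvg_ex; exists (2^-1 * a `^ (2^-1 - 1)).
    by apply: cvg_at_right_filter; exact: cdF.
  - apply/cvg_ex; exists (2^-1 * 0).
    apply: (@cvg_trans _ ((2^-1 * (F y)^-1) @[y --> +oo])).
      apply: near_eq_cvg; near=> y; rewrite dFneg//.
    apply: (@cvgMl_tmp _ _ (nbhs +oo) _ (fun y => (F y)^-1)); apply/gtr0_cvgV0 => //.
    by near=> y; rewrite /F powR_gt0//; near: y; exact: nbhs_pinfty_gt.
  - split; last by apply: cvg_at_right_filter; exact: continuous_powR_gt0.
    by move=> x xa; apply: derivable_powR; rewrite in_itv/= andbT ax.
  - exact: Fy.
  - apply: continuous_subspaceT => x; apply: cvgMl_tmp; exact: continuous_gauss_fun.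
  - by [].
have L1 := @cvg_integral_left_open 0 +oo%O harmonic
  (fun x => (x `^ (2^-1 - 1) * expR (- x))%:E) harmonic_gt0 nonincreasing_harmonic cvg_harmonic.
have L2 := @cvg_integral_left_open 0 +oo%O (F \o harmonic) (fun x => (G x)%:E).
have stepn : (fun n : nat => \int[mu]_(x in `[F (harmonic n), +oo[) (G x)%:E)%E =
    (fun n => \int[mu]_(x in `[harmonic n, +oo[) (x `^ (2^-1 - 1) * expR (- x))%:E)%E.
  by apply/funext => n; apply: step; exact: harmonic_gt0.
rewrite /Gamma /Rintegral.
have -> : (\int[mu]_(x in `]0%R, +oo[) (x `^ (2^-1 - 1) * expR (- x))%:E =
  \int[mu]_(x in `]0%R, +oo[) (G x)%:E)%E.
  apply: (@cvg_unique _ _ ((fun n : nat => \int[mu]_(x in `[F (harmonic n), +oo[) (G x)%:E) @ \oo)%E) => //.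
    rewrite stepn; apply: L1.
    + apply/measurable_EFinP; apply: measurable_funM; apply: measurable_funTS.
        exact: measurable_powR.
      by apply: measurableT_comp => //; exact: measurable_expR.
    + by move=> x _; rewrite lee_fin mulr_ge0 ?powR_ge0 ?expR_ge0.
  apply: L2.
  + by move=> n; rewrite /= powR_gt0 ?harmonic_gt0.
  + move=> m n mn /=; apply: ge0_ler_powR; last exact: nonincreasing_harmonic.
    1-3: by rewrite ?nnegrE ?invr_ge0 ?ler0n.
  + apply: ((cvg_at_rightP _ _ _).1 (powR_cvg0 _)); first by [].
    split; [exact: harmonic_gt0|exact: cvg_harmonic].
  + exact: measurable_funTS.
  + by move=> x _; rewrite lee_fin.
rewrite (integral_itv_obnd_cbnd (r := 0)); last exact: measurable_funTS.
under eq_integral do rewrite EFinM.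
rewrite ge0_integralZl//; last 2 first.
- by apply/measurable_EFinP; apply: measurable_funTS; exact: measurable_gauss_fun.
- by move=> x _; rewrite lee_fin gauss_fun_ge0.
by rewrite integral0y_gauss -EFinM /= mulrC divfK.
Unshelve. all: end_near. Qed.

Lemma bounded_integrable_itv (a b M : R) (f : R -> R) :
  measurable_fun `[a, b] f -> (forall x, a <= x <= b -> `|f x| <= M) ->
  mu.-integrable `[a, b] (EFin \o f).
Proof.
move=> mf fM; apply: measurable_bounded_integrable => //.
- by rewrite /= lebesgue_measure_itv/=; case: ifP; rewrite ?ltry// -EFinB ltry.
- exists M; split; first exact: num_real.
  move=> N MN x; rewrite /= in_itv/= => xab; exact: le_trans (fM _ xab) (ltW MN).
Qed.

End invariance.

(** * The kernel r^(-3/2) and Abel's integral *)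

Section abel.
Context {R : realType}.
Notation mu := (@lebesgue_measure R).
Implicit Types (b d s u x y z : R).

(** The power [r^(-3/2)], set to [0] for [r <= 0]. Integrals over [[0, s]] of a function
    of [s - u] thereby extend to the whole line, as Fubini's theorem wants. *)
Definition rm32 (r : R) : R := (r * Num.sqrt r)^-1.

Lemma rm32_le0 r : r <= 0 -> rm32 r = 0.
Proof. by move=> r0; rewrite /rm32 ler0_sqrtr// mulr0 invr0. Qed.

Lemma rm32_ge0 r : 0 <= rm32 r.
Proof.
have [/rm32_le0->//|r0] := leP r 0.
by rewrite invr_ge0 mulr_ge0 ?sqrtr_ge0 ?ltW.
Qed.

Lemma rm32_powR r (p : R) : p = 1 + 2^-1 -> 0 <= r -> (r `^ p)^-1 = rm32 r.
Proof.
move=> -> r0; rewrite powRD; last by apply/implyP => /eqP; lra.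
by rewrite powRr1// powR12_sqrt.
Qed.

Lemma measurable_sqrt D : measurable_fun D (@Num.sqrt R).
Proof.
by apply: measurable_funTS; apply: continuous_measurable_fun; exact: sqrt_continuous.
Qed.

Lemma measurable_inv D : measurable_fun D (@GRing.inv R).
Proof.
apply: measurable_funTS.
(* real powers are measurable on the whole line, and [1 / r = r * (r^2)^(-1)] *)
have -> : @GRing.inv R = (fun r => r * (`|r| * `|r|) `^ (-1)).
  apply/funext => r; rewrite powR_inv1 ?mulr_ge0// -normrM -expr2 ger0_norm ?sqr_ge0//.
  have [->|r0] := eqVneq r 0; first by rewrite invr0 mul0r.
  by rewrite expr2; field.
apply: measurable_funM => //.
have mn := @normr_measurable R setT.
exact: (measurableT_comp (measurable_powR (-1)) (measurable_funM mn mn)).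
Qed.

Lemma measurable_rm32 D : measurable_fun D rm32.
Proof.
apply: measurable_funTS; apply: (measurableT_comp (@measurable_inv setT)).
by apply: measurable_funM => //; exact: measurable_sqrt.
Qed.

Lemma rm32_le d r : 0 < d -> d <= r -> rm32 r <= rm32 d.
Proof.
move=> d0 dr; have r0 : 0 < r by exact: lt_le_trans dr.
rewrite lef_pV2 ?posrE ?mulr_gt0 ?sqrtr_gt0//.
by apply: ler_pM => //; rewrite ?sqrtr_ge0 ?ler_wsqrtr// ltW.
Qed.

Lemma continuous_rm32 r : 0 < r -> {for r, continuous rm32}.
Proof.
move=> r0; apply: cvgV; first by rewrite gt_eqF// mulr_gt0 ?sqrtr_gt0.
by apply: cvgM; [exact: cvg_id|exact: sqrt_continuous].
Qed.

Lemma integral_rm32 (a b : R) : 0 < a -> a <= b ->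
  (\int[mu]_(r in `[a, b]) (rm32 r)%:E = (2 * ((Num.sqrt a)^-1 - (Num.sqrt b)^-1))%:E)%E.
Proof.
move=> a0 ab.
pose F r := - 2 * (Num.sqrt r : R)^-1.
have -> : 2 * ((Num.sqrt a)^-1 - (Num.sqrt b)^-1) = F b - F a by rewrite /F; ring.
apply: FTC2; first exact: ab.
- apply: continuous_in_subspaceT => x; rewrite inE/= in_itv/= => /andP[ax _].
  by apply: continuous_rm32; exact: lt_le_trans ax.
- apply: continuous_in_subspaceT => x; rewrite inE/= in_itv/= => /andP[ax _].
  apply: cvgM; first exact: cvg_cst.
  apply: cvgV; last exact: sqrt_continuous.
  by rewrite gt_eqF// sqrtr_gt0; exact: lt_le_trans ax.
- move=> x /andP[ax _].
  have x0 : 0 < x by exact: lt_trans ax.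
  have sx0 : Num.sqrt x != 0 by rewrite gt_eqF// sqrtr_gt0.
  have h1 := is_derive1_sqrt x0.
  have h2 := is_deriveV sx0 h1.
  have h3 := is_deriveZ (-2) h2.
  apply: (is_derive_eq (df := _) h3).
  have := sqr_sqrtr (ltW x0); rewrite /GRing.scale/= /rm32; move: sx0.
  by move: (Num.sqrt x) => y y0 <-; field.
Qed.

(** With [w = sqrt((b - s)/(s - u))], the derivative of [w - atan w] is
    [w' w^2 / (1 + w^2)], where [1 + w^2 = (b - u)/(s - u)]. *)
Lemma is_derive_abel (u b x : R) : u < x < b ->
  is_derive x 1 (fun s => -2 * (Num.sqrt ((b - s) / (s - u)) - atan (Num.sqrt ((b - s) / (s - u)))))
   (Num.sqrt (b - x) * rm32 (x - u)).
Proof.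
move=> /andP[ux xb].
have xu : x - u != 0 by rewrite gt_eqF// subr_gt0.
have q0 : 0 < (b - x) / (x - u) by rewrite divr_gt0// subr_gt0.
have d1 : is_derive x 1 (fun s : R => b - s) (-1).
  by apply: (is_derive_eq (is_deriveB (is_derive_cst b x 1) (is_derive_id x 1))); rewrite sub0r.
have d2 : is_derive x 1 (fun s : R => s - u) 1.
  by apply: (is_derive_eq (is_deriveB (is_derive_id x 1) (is_derive_cst u x 1))); rewrite subr0.
have d3 := @is_deriveV _ (fun s => s - u) x _ _ xu d2.
have d4 := is_deriveM d1 d3.
pose q s := (b - s) / (s - u).
have d5 := @is_derive1_comp _ Num.sqrt q x _ _ (is_derive1_sqrt q0) d4.
have d6 := @is_derive1_comp _ (@atan R) (Num.sqrt \o q) x _ _ (is_derive1_atan (Num.sqrt (q x))) d5.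
have d7 := is_deriveZ (-2) (is_deriveB d5 d6).
apply: (is_derive_eq (df := _) d7).
rewrite /GRing.scale/= /q /rm32 sqrtrM ?subr_ge0 ?(ltW xb)// sqrtrV ?subr_ge0 ?(ltW ux)//.
have A0 : Num.sqrt (b - x) != 0 by rewrite gt_eqF// sqrtr_gt0 subr_gt0.
have B0 : Num.sqrt (x - u) != 0 by rewrite gt_eqF// sqrtr_gt0 subr_gt0.
have AE : Num.sqrt (b - x) ^+ 2 = b - x by rewrite sqr_sqrtr// subr_ge0 ltW.
have BE : Num.sqrt (x - u) ^+ 2 = x - u by rewrite sqr_sqrtr// subr_ge0 ltW.
move: (Num.sqrt (b - x)) (Num.sqrt (x - u)) A0 B0 AE BE => A B A0 B0 <- <-.
have AB : A ^+ 2 + B ^+ 2 != 0.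
  by rewrite gt_eqF// ltr_wpDl ?sqr_ge0// lt_neqAle sqr_ge0 andbT eq_sym expf_neq0.
by field; rewrite A0 B0 addrC AB.
Qed.

(** The value at [s = u + d] of the variable [sqrt((b - s)/(s - u))] of [is_derive_abel],
    with [y = b - u]; it vanishes when [y <= d], because the square root of a
    negative number is [0]. *)
Definition abelw d y : R := Num.sqrt (y / d - 1).

Lemma integral_abel (u b d : R) : 0 < d ->
  (\int[mu]_(s in `[(u + d)%R, b]) (Num.sqrt (b - s) * rm32 (s - u))%:E =
   (2 * (abelw d (b - u) - atan (abelw d (b - u))))%:E)%E.
Proof.
move=> d0; have [bud|ubd] := ltP b (u + d).
  rewrite set_itv_ge ?integral_set0; last by rewrite bnd_simp -ltNge.
  rewrite /abelw ler0_sqrtr ?atan0 ?subrr ?mulr0//.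
  by rewrite subr_le0 ler_pdivrMr// mul1r; lra.
pose q s := (b - s) / (s - u).
pose F s := -2 * (Num.sqrt (q s) - atan (Num.sqrt (q s))).
have -> : 2 * (abelw d (b - u) - atan (abelw d (b - u))) = F b - F (u + d).
  have -> : F b = 0 by rewrite /F /q subrr mul0r sqrtr0 atan0 subrr mulr0.
  have -> : F (u + d) = -2 * (abelw d (b - u) - atan (abelw d (b - u))).
    rewrite /F /q /abelw; do 3 f_equal; [|f_equal]; f_equal; field; lra.
  by ring.
apply: FTC2; first exact: ubd.
- apply: continuous_in_subspaceT => x; rewrite inE/= in_itv/= => /andP[ux xb].
  apply: cvgM.
    apply: (@continuous_comp _ _ _ (fun s => b - s)); last exact: sqrt_continuous.
    by apply: cvgB; [exact: cvg_cst|exact: cvg_id].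
  apply: (@continuous_comp _ _ _ (fun s => s - u)); last by apply: continuous_rm32; lra.
  by apply: cvgB; [exact: cvg_id|exact: cvg_cst].
- apply: continuous_in_subspaceT => x; rewrite inE/= in_itv/= => /andP[ux xb].
  have cq : {for x, continuous (Num.sqrt \o q)}.
    apply: (@continuous_comp _ _ _ q); last exact: sqrt_continuous.
    apply: cvgM; first by apply: cvgB; [exact: cvg_cst|exact: cvg_id].
    apply: cvgV; first by rewrite gt_eqF//; lra.
    by apply: cvgB; [exact: cvg_id|exact: cvg_cst].
  apply: cvgM; first exact: cvg_cst.
  apply: cvgB; first exact: cq.
  apply: (@continuous_comp _ _ _ (Num.sqrt \o q)); first exact: cq.
  exact: continuous_atan.
- move=> x /andP[ux xb]; apply: is_derive_abel; rewrite xb andbT; lra.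
Qed.

Lemma abelw_ge0 d y : 0 <= abelw d y. Proof. exact: sqrtr_ge0. Qed.

Lemma abelw_le d y : 0 < d -> 0 <= y -> abelw d y <= Num.sqrt y / Num.sqrt d.
Proof.
move=> d0 y0; rewrite -(sqrtrV (ltW d0)) -sqrtrM// /abelw ler_wsqrtr//; lra.
Qed.

Lemma abelw_ge d y : 0 < d -> 0 <= y -> Num.sqrt y / Num.sqrt d <= abelw d y + 1.
Proof.
move=> d0 y0; rewrite -(sqrtrV (ltW d0)) -sqrtrM//.
rewrite -(@ler_pXn2r _ 2) ?nnegrE ?sqrtr_ge0 ?addr_ge0 ?abelw_ge0//.
rewrite sqr_sqrtr ?mulr_ge0 ?invr_ge0 ?(ltW d0)// sqrrD1.
have := abelw_ge0 d y; rewrite /abelw.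
have [h|h] := leP 0 (y / d - 1); first by rewrite sqr_sqrtr//; lra.
rewrite ltr0_sqrtr// expr0n/= mul0rn; lra.
Qed.

Lemma cvg_abelw y : 0 < y -> abelw (harmonic n) y @[n --> \oo] --> +oo.
Proof.
move=> y0; apply/cvgryPge => A.
have A2 : 0 <= A ^+ 2 + 1 by rewrite addr_ge0 ?sqr_ge0.
near=> n; rewrite (le_trans (ler_norm A))// -sqrtr_sqr /abelw ler_wsqrtr// lerBrDr.
rewrite /harmonic/= invrK -ler_pdivrMl// mulrC.
rewrite -natr1; apply: (@le_trans _ _ n%:R); last by rewrite lerDl.
near: n; exact: nbhs_infty_ger.
Unshelve. all: end_near. Qed.

(** With [z = sqrt(y/d)] and [w = sqrt(z^2 - 1)], the difference [z - w = 1/(z + w)] tends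
    to [0] and [atan w] to [pi/2] as [d] tends to [0]. *)
Lemma cvg_abel y : 0 < y ->
  Num.sqrt y / Num.sqrt (harmonic n) - (abelw (harmonic n) y - atan (abelw (harmonic n) y))
   @[n --> \oo] --> pi / 2.
Proof.
move=> y0.
pose r n := (abelw (harmonic n) y + Num.sqrt y / Num.sqrt (harmonic n))^-1 : R.
have cw := cvg_abelw y0.
have r0 : r @ \oo --> 0.
  apply/gtr0_cvgV0.
    near=> n; rewrite ltr_wpDl ?abelw_ge0// divr_gt0 ?sqrtr_gt0//; exact: harmonic_gt0.
  apply/cvgryPge => A; move/cvgryPge : cw => /(_ A); apply: filterS => n /le_trans; apply.
  by rewrite lerDl divr_ge0 ?sqrtr_ge0.
have E : \forall n \near \oo, r n + atan (abelw (harmonic n) y) =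
   Num.sqrt y / Num.sqrt (harmonic n) - (abelw (harmonic n) y - atan (abelw (harmonic n) y)).
  move/cvgryPge : cw => /(_ 1); apply: filterS => n w1.
  rewrite opprB addrA [RHS]addrAC; congr (_ + _).
  have h0 := @harmonic_gt0 R n.
  have z0 : 0 < Num.sqrt y / Num.sqrt (harmonic n) by rewrite divr_gt0 ?sqrtr_gt0.
  apply: (@mulfI _ (abelw (harmonic n) y + Num.sqrt y / Num.sqrt (harmonic n))).
    by rewrite gt_eqF// ltr_wpDl// abelw_ge0.
  rewrite /r mulfV; last by rewrite gt_eqF// ltr_wpDl// abelw_ge0.
  rewrite [abelw _ _ + _]addrC mulrC -subr_sqr exprMn exprVn !sqr_sqrtr ?ltW//.
  rewrite /abelw; first by ring.
  by rewrite ltNge; apply/negP => h; move: w1; rewrite /abelw ler0_sqrtr// ler10.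
apply: (cvg_trans (near_eq_cvg E)).
rewrite -[pi / 2]add0r; apply: (cvgD r0).
by apply: (cvg_comp _ _ cw); exact: cvgy_atan.
Unshelve. all: end_near. Qed.

End abel.

(** * Abel inversion of the Marchaud derivative of order 1/2 *)

Lemma Rintegral_indic d (S : measurableType d) (R : realType) (m : {measure set S -> \bar R})
    (D : set S) (f : S -> R) :
  \int[m]_(x in D) f x = \int[m]_x (\1_D x * f x).
Proof.
rewrite Rintegral_mkcond; apply: eq_Rintegral => x _.
by rewrite patch_indic /= mulrC.
Qed.

Lemma integrable_indicP d (S : measurableType d) (R : realType) (m : {measure set S -> \bar R})
    (D : set S) (f : S -> R) : measurable D ->
  m.-integrable D (EFin \o f) <-> m.-integrable setT (EFin \o (fun x => \1_D x * f x)).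
Proof.
move=> mD; rewrite (integrable_mkcond _ mD).
rewrite (_ : (EFin \o f) \_ D = EFin \o (fun x => \1_D x * f x))//.
apply/funext => x; rewrite /= restrict_EFin/= patch_indic/= mulrC//.
Qed.

Lemma eq_integral_support d (S : measurableType d) (R : realType) (m : {measure set S -> \bar R})
    (A B : set S) (f g : S -> \bar R) :
  (forall x, A x -> B x -> f x = g x) -> (forall x, A x -> ~ B x -> f x = 0%E) ->
  (forall x, B x -> ~ A x -> g x = 0%E) ->
  (\int[m]_(x in A) f x = \int[m]_(x in B) g x)%E.
Proof.
move=> fg f0 g0; rewrite integral_mkcond [RHS]integral_mkcond.
apply: eq_integral => x _; rewrite /patch.
case: ifPn => [/set_mem Ax|/negP Ax]; case: ifPn => [/set_mem Bx|/negP Bx].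
- exact: fg.
- by apply: f0 => // Bx'; apply: Bx; rewrite inE.
- by apply/esym/g0 => // Ax'; apply: Ax; rewrite inE.
- by [].
Qed.

Section kernel.
Context {R : realType}.
Notation mu := (@lebesgue_measure R).
Implicit Types (d b s u r : R).

(** Cutting the kernel off at lag [d] makes it bounded, so that the double integral of
    [(Phi s - Phi u) rm32 (s - u)] can be split into a term in [Phi s] and a term in
    [Phi u]; each of them diverges without the cut-off. *)
Definition rm32_cut d r : R := if d <= r then rm32 r else 0.

Lemma measurable_rm32_cut d D : measurable_fun D (rm32_cut d).
Proof.
apply: measurable_funTS; apply: measurable_fun_ifT => //.
- exact: measurable_fun_ler.
- exact: measurable_rm32.
Qed.

Lemma rm32_cut_ge0 d r : 0 <= rm32_cut d r.
Proof. by rewrite /rm32_cut; case: ifP => // _; exact: rm32_ge0. Qed.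

Lemma rm32_cut_le d r : rm32_cut d r <= rm32 r.
Proof. by rewrite /rm32_cut; case: ifP => // _; exact: rm32_ge0. Qed.

Lemma rm32_cut_bound d r : 0 < d -> rm32_cut d r <= rm32 d.
Proof.
move=> d0; rewrite /rm32_cut; case: ifP => [|_]; last exact: rm32_ge0.
exact: rm32_le.
Qed.

Lemma rm32_cut_lt d r : r < d -> rm32_cut d r = 0.
Proof. by move=> rd; rewrite /rm32_cut leNgt rd. Qed.

Lemma cvg_rm32_cut r : rm32_cut (harmonic n) r @[n --> \oo] --> rm32 r.
Proof.
have [r0|r0] := leP r 0.
  rewrite rm32_le0//; apply: cvg_near_cst; apply: nearW => n.
  by rewrite rm32_cut_lt// (le_lt_trans r0)// harmonic_gt0.
apply: cvg_near_cst.
have := @cvg_harmonic R => /cvgr_le /(_ _ r0); apply: filterS => n h.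
by rewrite /rm32_cut h.
Qed.

Lemma integral_rm32_cut_left d b s : 0 < d -> s \in `[0, b] ->
  (\int[mu]_(u in `[0%R, b]) (rm32_cut d (s - u))%:E =
   (if d <= s then 2 * ((Num.sqrt d)^-1 - (Num.sqrt s)^-1) else 0)%:E)%E.
Proof.
rewrite in_itv/= => d0 /andP[s0 sb].
transitivity (\int[mu]_(u in `[0%R, s]) (rm32_cut d (s - u))%:E)%E.
  apply: eq_integral_support => u /=; rewrite !in_itv//= => hu /negP hu'.
    by rewrite rm32_cut_lt//; lra.
  by exfalso; move: hu'; lra.
rewrite (@ge0_integral_reflect _ s (fun r => (rm32_cut d r)%:E)); last 2 first.
- by apply/measurable_EFinP; exact: measurable_rm32_cut.
- by move=> y; rewrite lee_fin rm32_cut_ge0.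
case: ifPn => ds; last first.
  apply: integral0_eq => r; rewrite /= in_itv/= => rs.
  by rewrite rm32_cut_lt//; lra.
rewrite -integral_rm32//; apply: eq_integral_support => u /=; rewrite !in_itv/= => hu.
- by move=> hu'; rewrite /rm32_cut ifT//; lra.
- by move=> /negP hu'; rewrite rm32_cut_lt//; lra.
- by move=> /negP ?; exfalso; lra.
Qed.

Lemma integral_rm32_cut_right d b u : 0 < d -> u \in `[0, b] ->
  (\int[mu]_(s in `[0%R, b]) (Num.sqrt (b - s) * rm32_cut d (s - u))%:E =
   (2 * (abelw d (b - u) - atan (abelw d (b - u))))%:E)%E.
Proof.
rewrite in_itv/= => d0 /andP[u0 ub].
rewrite -integral_abel//; apply: eq_integral_support => s /=; rewrite !in_itv/= => hs.
- by move=> hs'; rewrite /rm32_cut ifT//; lra.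
- by move=> /negP hs'; rewrite rm32_cut_lt ?mulr0//; lra.
- by move=> /negP ?; exfalso; lra.
Qed.
End kernel.

Section marchaud.
Context {R : realType}.
Notation mu := (@lebesgue_measure R).
Variables (Phi : R -> R) (K b : R).
Hypotheses (b0 : 0 < b) (mPhi : measurable_fun setT Phi)
  (PhiK : forall s, `|Phi s| <= K).
Hypothesis Phifin : (\int[mu]_(s in `[0%R, b]) \int[mu]_(u in `[0%R, s])
   (`|Phi u - Phi s| * rm32 (s - u))%:E < +oo)%E.

(** The left fractional derivative of order [1/2] without its factor [1/Gamma(1/2)]. *)
Definition marchaud (s : R) : R := Phi s / Num.sqrt s +
  2^-1 * \int[mu]_(u in `[0, s]) ((Phi s - Phi u) * rm32 (s - u)).

Let D : set R := `[0, b]%classic.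
Let mD : measurable D. Proof. exact: measurable_itv. Qed.
Let chi (z : measurableTypeR R * measurableTypeR R) : R := \1_D z.1 * \1_D z.2.

Let inD s : (s \in D) = (0 <= s <= b).
Proof. by rewrite mem_setE in_itv. Qed.

Let indD1 s : 0 <= s <= b -> \1_D s = 1 :> R.
Proof. by move=> sb; rewrite indicE inD sb. Qed.

Let indD0 s : ~~ (0 <= s <= b) -> \1_D s = 0 :> R.
Proof. by move=> sb; rewrite indicE inD (negbTE sb). Qed.

Let mchi : measurable_fun setT chi.
Proof.
apply: measurable_funM.
  have h := @measurable_indic _ (measurableTypeR R) R setT D mD.
  exact: (measurableT_comp h measurable_fst).
have h := @measurable_indic _ (measurableTypeR R) R setT D mD.
exact: (measurableT_comp h measurable_snd).
Qed.

Let chi01 z : 0 <= chi z <= 1.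
Proof. by rewrite /chi !indicE; do 2 case: (_ \in _); rewrite ?mulr1 ?mulr0 lexx ler01. Qed.

Let K0 : 0 <= K. Proof. exact: le_trans (PhiK 0). Qed.

Let mdiff : measurable_fun setT (fun z : measurableTypeR R * measurableTypeR R => z.1 - z.2).
Proof. by apply: measurable_funB. Qed.

Let mPhi1 : measurable_fun setT (fun z : measurableTypeR R * measurableTypeR R => Phi z.1).
Proof. exact: (measurableT_comp mPhi measurable_fst). Qed.

Let mPhi2 : measurable_fun setT (fun z : measurableTypeR R * measurableTypeR R => Phi z.2).
Proof. exact: (measurableT_comp mPhi measurable_snd). Qed.

Let msb : measurable_fun setT (fun z : measurableTypeR R * measurableTypeR R => Num.sqrt (b - z.1)).
Proof.
apply: (measurableT_comp (@measurable_sqrt _ setT)).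
by apply: measurable_funB.
Qed.

Let f0 (z : measurableTypeR R * measurableTypeR R) : R := chi z * ((Phi z.1 - Phi z.2) * rm32 (z.1 - z.2)).

Let f0E s u : f0 (s, u) = \1_D s * \1_D u * ((Phi s - Phi u) * rm32 (s - u)).
Proof. by []. Qed.

Let mf0 : measurable_fun setT f0.
Proof.
apply: (measurable_funM mchi); apply: measurable_funM.
  by apply: measurable_funB.
exact: (measurableT_comp (@measurable_rm32 _ setT) mdiff).
Qed.

Let if0 : (mu \x mu)%E.-integrable setT (EFin \o f0).
Proof.
have mE : measurable_fun setT (EFin \o f0) by exact/measurable_EFinP.
apply/(integrable12ltyP _ _ mE).
apply: le_lt_trans Phifin; rewrite le_eqVlt; apply/orP; left; apply/eqP/esym.
rewrite integral_mkcond; apply: eq_integral => s _; rewrite /patch.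
case: ifPn => [/set_mem sD|sD]; last first.
  apply/esym/integral0_eq => u _ /=.
  by rewrite f0E indicE (negbTE sD) !mul0r normr0.
rewrite integral_mkcond; apply: eq_integral => u _; rewrite /patch.
have s0b : 0 <= s <= b by rewrite -inD inE.
rewrite [RHS]/= f0E (indD1 s0b) mul1r.
case: ifPn => [/set_mem us|/negP us].
  rewrite /= in_itv/= in us.
  rewrite indD1 ?mul1r; last by lra.
  by rewrite normrM (ger0_norm (rm32_ge0 _)) distrC.
rewrite inE/= in_itv/= in us; move/negP : us => us.
have [u0|u0] := ltP u 0.
  by rewrite indD0 ?mul0r ?normr0//; lra.
by rewrite rm32_le0 ?mulr0 ?normr0//; lra.
Qed.

Let I (s : R) := \int[mu]_(u in `[0, s]) ((Phi s - Phi u) * rm32 (s - u)).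

Let f0I s : \int[mu]_u f0 (s, u) = \1_D s * I s.
Proof.
have [sD|sD] := boolP (s \in D); last first.
  rewrite indicE (negbTE sD) mul0r -(Rintegral_set0 mu (fun u => f0 (s, u))).
  rewrite /Rintegral; congr fine; apply: eq_integral_support => // u _ _.
  by rewrite f0E indicE (negbTE sD) !mul0r.
have s0b : 0 <= s <= b by rewrite -inD.
rewrite indicE sD mul1r /I /Rintegral; congr fine; apply: eq_integral_support => //= u.
  move=> _; rewrite in_itv/= => us.
  by rewrite f0E !indD1 ?mul1r//; lra.
move=> _; rewrite in_itv/= => /negP us.
rewrite f0E; have [u0|u0] := ltP u 0.
  by rewrite (@indD0 u) ?mulr0 ?mul0r//; lra.
by rewrite rm32_le0 ?mulr0//; lra.
Qed.

Let iI : mu.-integrable D (EFin \o I).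
Proof.
apply/integrable_indicP => //.
have [+ _] := Rfubini1 if0.
by under eq_fun do rewrite f0I.
Qed.

Let irsqrt : mu.-integrable D (EFin \o (fun s => (Num.sqrt s)^-1)).
Proof.
have m : measurable_fun D (fun s : R => (Num.sqrt s)^-1).
  exact: (measurableT_comp (@measurable_inv _ setT) (@measurable_sqrt _ D)).
apply/integrableP; split; first exact/measurable_EFinP.
have -> : (\int[mu]_(x in D) `|(EFin \o (fun s : R => (Num.sqrt s)^-1)%R) x| =
   \int[mu]_(x in D) (x `^ (2^-1 - 1))%:E)%E.
  apply: eq_integral => x; rewrite inD => /andP[x0 _].
  rewrite [LHS]/= ger0_norm ?invr_ge0 ?sqrtr_ge0// -powR12_sqrt// -powRN.
  by congr (_ `^ _)%:E; field.
by rewrite integral_powR ?ltry// ltW.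
Qed.

Let irsPhi : mu.-integrable D (EFin \o (fun s => Phi s / Num.sqrt s)).
Proof.
apply: (@le_integrable_EFin _ _ _ _ _ _ (fun s : measurableTypeR R => K * (Num.sqrt s)^-1)) => //.
- apply: measurable_funM; first exact: measurable_funTS.
  exact: (measurableT_comp (@measurable_inv _ setT) (@measurable_sqrt _ D)).
- move=> s _ /=; rewrite normrM (ger0_norm (_ : 0 <= (Num.sqrt s)^-1)) ?invr_ge0 ?sqrtr_ge0//.
  by rewrite ler_wpM2r ?invr_ge0 ?sqrtr_ge0.
- exact: (@integrableZl _ _ _ mu _ mD K _ irsqrt).
Qed.

Lemma integrable_marchaud : mu.-integrable D (EFin \o marchaud).
Proof.
have h := @integrableD _ _ _ mu _ mD _ _ irsPhi (@integrableZl _ _ _ mu _ mD 2^-1 _ iI).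
exact: h.
Qed.

Let sqb s : s \in D -> Num.sqrt (b - s) <= Num.sqrt b.
Proof. by rewrite inD => sb; rewrite ler_wsqrtr//; lra. Qed.

Let F (z : measurableTypeR R * measurableTypeR R) := f0 z * Num.sqrt (b - z.1).

Let iF : (mu \x mu)%E.-integrable setT (EFin \o F).
Proof.
apply: (@le_integrable_EFin _ _ _ _ _ _ (fun z => Num.sqrt b * `|f0 z|)) => //.
- exact: (measurable_funM mf0 msb).
- move=> z _ /=; rewrite /F mulrC !normrM (ger0_norm (sqrtr_ge0 _)).
  have [zD|zD] := boolP (z.1 \in D); first by rewrite ler_wpM2r// sqb.
  by rewrite /f0 /chi [\1_D z.1]indicE (negbTE zD) normr0 !mul0r !mulr0.
- exact: (integrableZl measurableT (Num.sqrt b) (integrable_norm if0)).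
Qed.

Let intF : \int[(mu \x mu)%E]_z F z = \int[mu]_(s in D) (I s * Num.sqrt (b - s)).
Proof.
rewrite -(Rfubini1 iF).2 [RHS]Rintegral_indic /Rintegral; congr fine.
have [h1 _] := Rfubini1 iF.
apply: ae_eq_integral => //.
- exact: measurable_int h1.
- apply/measurable_EFinP; under eq_fun do rewrite mulrA.
  apply: measurable_funM; last first.
    apply: (measurableT_comp (@measurable_sqrt _ setT)); exact: measurable_funB.
  apply/measurable_EFinP; exact: measurable_int ((integrable_indicP _ _ _).1 iI).
- have := ae_integrable1 if0; apply: filterS => s h _.
  by rewrite -[LHS]/((\int[mu]_u (f0 (s, u) * Num.sqrt (b - s)))%:E) RintegralZr// f0I mulrA.
Qed.

Let bounded_integrable (g : measurableTypeR R * measurableTypeR R -> R) (C : R) :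
  measurable_fun setT g -> (forall z, `|g z| <= C * chi z) ->
  (mu \x mu)%E.-integrable setT (EFin \o g).
Proof.
move=> mg gC; apply: (@le_integrable_EFin _ _ _ _ _ _ (fun z => C * chi z)) => //.
suff h : (mu \x mu)%E.-integrable setT (EFin \o chi) by exact: (integrableZl measurableT C h).
have m1 : mu.-integrable setT (EFin \o (\1_D : R -> R)) by exact: integrable_indic_itv.
have mE : measurable_fun setT (EFin \o chi) by exact/measurable_EFinP.
apply/(integrable12ltyP _ _ mE).
have -> : (\int[mu]_x \int[mu]_y `|(EFin \o chi) (x, y)| =
    \int[mu]_x ((\1_D x)%:E * \int[mu]_y (\1_D y)%:E))%E.
  apply: eq_integral => x _; rewrite -ge0_integralZl//; last first.
    by apply/measurable_EFinP; exact: measurable_indic.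
  by apply: eq_integral => y _; rewrite /= ger0_norm// mulr_ge0.
have muD : mu D = b%:E.
  by rewrite /D /= lebesgue_measure_itv/= lte_fin b0 oppr0 adde0.
have muI : (\int[mu]_y (\1_D y)%:E = b%:E)%E by rewrite integral_indic// setIT.
rewrite muI ge0_integralZr//; last 2 first.
- by apply/measurable_EFinP; exact: measurable_indic.
- by rewrite lee_fin ltW.
by rewrite muI -EFinM ltry.
Qed.

Let Fn (n : nat) (z : measurableTypeR R * measurableTypeR R) :=
  chi z * ((Phi z.1 - Phi z.2) * rm32_cut (harmonic n) (z.1 - z.2)) * Num.sqrt (b - z.1).

Let mcut n : measurable_fun setT
  (fun z : measurableTypeR R * measurableTypeR R => rm32_cut (harmonic n) (z.1 - z.2)).
Proof. exact: (measurableT_comp (@measurable_rm32_cut _ (harmonic n) setT) mdiff). Qed.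

Let mFn n : measurable_fun setT (Fn n).
Proof.
apply: measurable_funM => //; apply: (measurable_funM mchi); apply: measurable_funM => //.
exact: measurable_funB.
Qed.

Let cvgFn : \int[(mu \x mu)%E]_z Fn n z @[n --> \oo] --> \int[(mu \x mu)%E]_z F z.
Proof.
apply: (@Rintegral_dominated_cvg _ _ _ _ _ Fn F (fun z => `|F z|) _ _ _ _ _ _).2 => //.
- exact: (measurable_funM mf0 msb).
- apply: aeW => z _; apply: cvgMr_tmp; apply: cvgMl_tmp; apply: cvgMl_tmp.
  exact: cvg_rm32_cut.
- exact: (integrable_norm iF).
- move=> n z _; rewrite /Fn /F /f0 !normrM ler_wpM2r// ler_wpM2l// ler_wpM2l//.
  by rewrite !ger0_norm ?rm32_ge0 ?rm32_cut_ge0 ?rm32_cut_le.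
Qed.

(* [m1 n s] is the mass of the cut-off kernel in the variable [u], and [m2 n u] is its
   mass in the variable [s] against [sqrt(b - s)]. *)
Let m1 n s : R := if harmonic n <= s
  then 2 * ((Num.sqrt (harmonic n))^-1 - (Num.sqrt s)^-1) else 0.
Let m2 n u : R := 2 * (abelw (harmonic n) (b - u) - atan (abelw (harmonic n) (b - u))).

Let F1 n (z : measurableTypeR R * measurableTypeR R) :=
  chi z * (Phi z.1 * rm32_cut (harmonic n) (z.1 - z.2) * Num.sqrt (b - z.1)).
Let F2 n (z : measurableTypeR R * measurableTypeR R) :=
  chi z * (Phi z.2 * rm32_cut (harmonic n) (z.1 - z.2) * Num.sqrt (b - z.1)).

Let chi_bound z (c p : R) n : `|c| <= K ->
  `|chi z * (c * rm32_cut (harmonic n) p * Num.sqrt (b - z.1))|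
   <= (K * rm32 (harmonic n) * Num.sqrt b) * chi z.
Proof.
move=> cK; rewrite mulrC normrM (ger0_norm (andP (chi01 z)).1).
have [zD|zD] := boolP (z.1 \in D); last by rewrite /chi indicE (negbTE zD) !mul0r !mulr0.
rewrite ler_wpM2r ?(andP (chi01 z)).1// !normrM ler_pM ?mulr_ge0//.
  rewrite ler_pM// ger0_norm ?rm32_cut_ge0// rm32_cut_bound//; exact: harmonic_gt0.
by rewrite ger0_norm ?sqrtr_ge0// sqb.
Qed.

Let iF1 n : (mu \x mu)%E.-integrable setT (EFin \o F1 n).
Proof.
apply: (@bounded_integrable _ (K * rm32 (harmonic n) * Num.sqrt b)); last first.
  by move=> z; apply: chi_bound.
apply: (measurable_funM mchi); apply: measurable_funM => //; exact: measurable_funM.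
Qed.

Let iF2 n : (mu \x mu)%E.-integrable setT (EFin \o F2 n).
Proof.
apply: (@bounded_integrable _ (K * rm32 (harmonic n) * Num.sqrt b)); last first.
  by move=> z; apply: chi_bound.
apply: (measurable_funM mchi); apply: measurable_funM => //; exact: measurable_funM.
Qed.

Let F1E n s : \int[mu]_u F1 n (s, u) = \1_D s * (Phi s * Num.sqrt (b - s) * m1 n s).
Proof.
have [sD|sD] := boolP (0 <= s <= b); last first.
  rewrite indD0// mul0r /Rintegral integral0_eq// => u _.
  by rewrite /F1 /chi /= indD0// !mul0r.
have -> : \int[mu]_u F1 n (s, u) =
    \int[mu]_(u in D) (Phi s * Num.sqrt (b - s) * rm32_cut (harmonic n) (s - u)).
  rewrite [RHS]Rintegral_indic; apply: eq_Rintegral => u _.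
  by rewrite /F1 /chi/= indD1//; ring.
have mc : measurable_fun D (fun u => rm32_cut (harmonic n) (s - u)).
  apply: (measurableT_comp (@measurable_rm32_cut _ (harmonic n) setT)).
  exact: measurable_funB.
have h := integral_rm32_cut_left (harmonic_gt0 n) (_ : s \in `[0, b]).
rewrite RintegralZl//.
  rewrite indD1// mul1r; congr (_ * _); rewrite /Rintegral h//.
apply/integrableP; split; first exact/measurable_EFinP.
under eq_integral do rewrite /= ger0_norm ?rm32_cut_ge0//.
by rewrite h ?ltry.
Qed.

Let F2E n u : \int[mu]_s F2 n (s, u) = \1_D u * (Phi u * m2 n u).
Proof.
have [uD|uD] := boolP (0 <= u <= b); last first.
  rewrite indD0// mul0r /Rintegral integral0_eq// => s _.
  by rewrite /F2 /chi /= (indD0 uD) mulr0 !mul0r.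
have -> : \int[mu]_s F2 n (s, u) =
    \int[mu]_(s in D) (Phi u * (Num.sqrt (b - s) * rm32_cut (harmonic n) (s - u))).
  rewrite [RHS]Rintegral_indic; apply: eq_Rintegral => s _.
  by rewrite /F2 /chi/= (indD1 uD); ring.
have mc : measurable_fun D (fun s => Num.sqrt (b - s) * rm32_cut (harmonic n) (s - u)).
  apply: measurable_funM.
    apply: (measurableT_comp (@measurable_sqrt _ setT)); exact: measurable_funB.
  apply: (measurableT_comp (@measurable_rm32_cut _ (harmonic n) setT)).
  exact: measurable_funB.
have h := integral_rm32_cut_right (harmonic_gt0 n) (_ : u \in `[0, b]).
rewrite RintegralZl//.
  rewrite indD1// mul1r; congr (_ * _); rewrite /Rintegral h//.
apply/integrableP; split; first exact/measurable_EFinP.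
under eq_integral do rewrite /= ger0_norm ?mulr_ge0 ?sqrtr_ge0 ?rm32_cut_ge0//.
by rewrite h ?ltry.
Qed.

Let intFn n : mu.-integrable D (EFin \o (fun s => Phi s * (Num.sqrt (b - s) * m1 n s - m2 n s))) /\
  \int[(mu \x mu)%E]_z Fn n z =
  \int[mu]_(s in D) (Phi s * (Num.sqrt (b - s) * m1 n s - m2 n s)).
Proof.
have [i1 e1] := Rfubini1 (iF1 n); have [i2 e2] := Rfubini2 (iF2 n).
have E : (fun s => Phi s * (Num.sqrt (b - s) * m1 n s - m2 n s)) =
   (fun s => Phi s * Num.sqrt (b - s) * m1 n s - Phi s * m2 n s).
  by apply/funext => s; ring.
have j1 : mu.-integrable D (EFin \o (fun s => Phi s * Num.sqrt (b - s) * m1 n s)).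
  apply/integrable_indicP => //; move: i1.
  by under eq_fun do rewrite F1E.
have j2 : mu.-integrable D (EFin \o (fun s => Phi s * m2 n s)).
  apply/integrable_indicP => //; move: i2.
  by under eq_fun do rewrite F2E.
rewrite E; split; first exact: (@integrableB _ _ _ mu _ mD _ _ j1 j2).
rewrite RintegralB// [X in _ = X - _]Rintegral_indic [X in _ = _ - X]Rintegral_indic.
have -> : \int[(mu \x mu)%E]_z Fn n z = \int[(mu \x mu)%E]_z (F1 n z - F2 n z).
  by apply: eq_Rintegral => z _; rewrite /Fn /F1 /F2; ring.
have e1' : \int[(mu \x mu)%E]_z F1 n z = \int[mu]_s \int[mu]_u F1 n (s, u) := esym e1.
have e2' : \int[(mu \x mu)%E]_z F2 n z = \int[mu]_u \int[mu]_s F2 n (s, u) := esym e2.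
rewrite RintegralB// e1' e2'; congr (_ - _); apply: eq_Rintegral => s _.
  by rewrite F1E.
by rewrite F2E.
Qed.

(* The weight of [Phi s] in the cut-off version of the integral of
   [marchaud s * sqrt(b - s)], once both halves of the double integral have been
   written in terms of the same variable. *)
Let ker n s := Num.sqrt (b - s) / Num.sqrt s + 2^-1 * (Num.sqrt (b - s) * m1 n s - m2 n s).

Let kerE n s : 0 < s <= b -> harmonic n <= s ->
  ker n s = Num.sqrt (b - s) / Num.sqrt (harmonic n) -
    (abelw (harmonic n) (b - s) - atan (abelw (harmonic n) (b - s))).
Proof.
move=> sb h; rewrite /ker /m1 /m2 h; field.
rewrite gt_eqF ?sqrtr_gt0 ?harmonic_gt0//.
by rewrite gt_eqF ?sqrtr_gt0//; lra.
Qed.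

Let atan_ge0 (w : R) : 0 <= w -> 0 <= atan w.
Proof. by move=> w0; rewrite -atan0 le_atan. Qed.

Let ker_bound n s : 0 < s <= b -> `|ker n s| <= 1 + pi / 2 + Num.sqrt b * (Num.sqrt s)^-1.
Proof.
move=> sb; have h0 := @harmonic_gt0 R n.
have y0 : 0 <= b - s by lra.
have w0 := abelw_ge0 (harmonic n) (b - s).
have w1 := abelw_le h0 y0.
have w2 := abelw_ge h0 y0.
have a0 := atan_ge0 w0.
have a1 := ltW (atan_ltpi2 (abelw (harmonic n) (b - s))).
have s0 : 0 < Num.sqrt s by rewrite sqrtr_gt0; lra.
have bs : 0 <= Num.sqrt b * (Num.sqrt s)^-1 by rewrite mulr_ge0 ?invr_ge0.
have [hs|hs] := leP (harmonic n) s; first by rewrite kerE// ler_norml; lra.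
have w3 : Num.sqrt (b - s) / Num.sqrt (harmonic n) <= Num.sqrt (b - s) / Num.sqrt s.
  rewrite ler_wpM2l// lef_pV2 ?posrE// ?sqrtr_gt0//.
  by rewrite ler_wsqrtr// ltW.
have w4 : Num.sqrt (b - s) / Num.sqrt s <= Num.sqrt b * (Num.sqrt s)^-1.
  by rewrite ler_wpM2r ?invr_ge0 ?(ltW s0)// ler_wsqrtr//; lra.
rewrite /ker /m1 /m2; case: ifPn => [|_]; first by rewrite leNgt hs.
rewrite ler_norml; lra.
Qed.

Let cvg_ker s : 0 < s < b -> ker n s @[n --> \oo] --> pi / 2.
Proof.
move=> sb; have y0 : 0 < b - s by lra.
have s0 : 0 < s by lra.
apply: (cvg_trans _ (cvg_abel y0)); apply: near_eq_cvg.
have := @cvg_harmonic R => /cvgr_le /(_ _ s0); apply: filterS => n h.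
by rewrite kerE//; lra.
Qed.

Let mker0 : measurable_fun setT (fun s : R => Num.sqrt (b - s)).
Proof. by apply: (measurableT_comp (@measurable_sqrt _ setT)); exact: measurable_funB. Qed.

Let irs : mu.-integrable D (EFin \o (fun s => Phi s / Num.sqrt s * Num.sqrt (b - s))).
Proof.
apply: (@le_integrable_EFin _ _ _ _ _ _
  (fun s : measurableTypeR R => Num.sqrt b * `|Phi s / Num.sqrt s|)) => //.
- apply: measurable_funM; last exact: measurable_funTS.
  by apply/measurable_EFinP; exact: measurable_int irsPhi.
- move=> s sD; rewrite normrM (ger0_norm (sqrtr_ge0 _)) mulrC ler_wpM2r//.
  by apply: sqb; rewrite inE.
- exact: (@integrableZl _ _ _ mu _ mD (Num.sqrt b) _ (integrable_norm irsPhi)).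
Qed.

Let iker n : mu.-integrable D (EFin \o (fun s => Phi s * ker n s)) /\
  \int[mu]_(s in D) (Phi s * ker n s) =
  \int[mu]_(s in D) (Phi s / Num.sqrt s * Num.sqrt (b - s)) + 2^-1 * \int[(mu \x mu)%E]_z Fn n z.
Proof.
have [i1 e1] := intFn n.
have i2 : mu.-integrable D (EFin \o (fun s => 2^-1 * (Phi s * (Num.sqrt (b - s) * m1 n s - m2 n s)))).
  exact: (@integrableZl _ _ _ mu _ mD 2^-1 _ i1).
have -> : (fun s => Phi s * ker n s) = (fun s => Phi s / Num.sqrt s * Num.sqrt (b - s) +
    2^-1 * (Phi s * (Num.sqrt (b - s) * m1 n s - m2 n s))).
  by apply/funext => s; rewrite /ker; ring.
split; first exact: (@integrableD _ _ _ mu _ mD _ _ irs i2).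
by rewrite RintegralD// RintegralZl// e1.
Qed.

Let mker n : measurable_fun D (fun s => Phi s * ker n s).
Proof. by apply/measurable_EFinP; exact: measurable_int (iker n).1. Qed.

(** The Abel transform inverts the fractional derivative. With the singularity cut off
    at lag [1/(n+1)], Fubini's theorem rewrites the left-hand side as the integral of [Phi]
    against the explicit weight [ker n]. The divergent parts of its two halves cancel, and
    the rest converges boundedly, up to an integrable [1/sqrt s], to [pi/2] by [cvg_abel]. *)
Lemma marchaud_abel : \int[mu]_(s in D) (marchaud s * Num.sqrt (b - s)) =
  pi / 2 * \int[mu]_(s in D) Phi s.
Proof.
have iPhi : mu.-integrable D (EFin \o Phi).
  by apply: (@bounded_integrable_itv _ _ _ K); [exact: measurable_funTS|move=> s _].
have iIs : mu.-integrable D (EFin \o (fun s => I s * Num.sqrt (b - s))).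
  apply: (@le_integrable_EFin _ _ _ _ _ _ (fun s : measurableTypeR R => Num.sqrt b * `|I s|)) => //.
  - apply: measurable_funM; last exact: measurable_funTS.
    by apply/measurable_EFinP; exact: measurable_int iI.
  - move=> s sD; rewrite normrM (ger0_norm (sqrtr_ge0 _)) mulrC ler_wpM2r//.
    by apply: sqb; rewrite inE.
  - exact: (@integrableZl _ _ _ mu _ mD (Num.sqrt b) _ (integrable_norm iI)).
have E : \int[mu]_(s in D) (marchaud s * Num.sqrt (b - s)) =
    \int[mu]_(s in D) (Phi s / Num.sqrt s * Num.sqrt (b - s)) +
    2^-1 * \int[(mu \x mu)%E]_z F z.
  rewrite intF -RintegralZl// -RintegralD//; last first.
    exact: (@integrableZl _ _ _ mu _ mD 2^-1 _ iIs).
  by apply: eq_Rintegral => s _; rewrite /marchaud -/(I s); ring.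
have L1 : \int[mu]_(s in D) (Phi s * ker n s) @[n --> \oo] -->
    \int[mu]_(s in D) (marchaud s * Num.sqrt (b - s)).
  rewrite E; under eq_fun do rewrite (iker _).2.
  by apply: cvgD; [exact: cvg_cst|apply: cvgMl_tmp; exact: cvgFn].
have D0E (g : R -> R) : mu.-integrable D (EFin \o g) ->
    \int[mu]_(s in D) g s = \int[mu]_(s in `]0, b]) g s.
  move=> ig; rewrite /D Rintegral_itv_obnd_cbnd//.
  by apply: integrableS ig => //; exact: subset_itv_oc_cc.
have D0D : `]0, b]%classic `<=` D by exact: subset_itv_oc_cc.
have L2 : \int[mu]_(s in D) (Phi s * ker n s) @[n --> \oo] -->
    \int[mu]_(s in D) (pi / 2 * Phi s).
  have iP : mu.-integrable D (EFin \o (fun s => pi / 2 * Phi s)).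
    exact: (@integrableZl _ _ _ mu _ mD (pi / 2) _ iPhi).
  rewrite (D0E _ iP).
  under eq_fun do rewrite (D0E _ (iker _).1).
  have dom := @Rintegral_dominated_cvg R _ (measurableTypeR R) mu `]0, b]%classic
    (fun n s => Phi s * ker n s) (fun s => pi / 2 * Phi s)
    (fun s => K * (1 + pi / 2) + K * Num.sqrt b * (Num.sqrt s)^-1).
  apply: (dom _ _ _ _ _ _).2; first exact: measurable_itv.
  - by move=> n; apply: measurable_funS (mker n).
  - by apply: measurable_funTS; exact: measurable_funM.
  (* the weight tends to [pi / 2] at every point of ]0, b] except [b] *)
  - have h : mu.-negligible [set b].
    by apply/negligibleP => //; exact: lebesgue_measure_set1.
    apply: negligibleS h => s /= /not_implyP[]; rewrite in_itv/= => sb.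
    move=> nc; apply: contrapT => /eqP sb'; apply: nc.
    rewrite [X in _ --> X]mulrC; apply: cvgMl_tmp; apply: cvg_ker.
    by rewrite (lt_neqAle s b) sb'; lra.
  - apply: (@integrableD _ _ _ mu _ _ (fun=> (K * (1 + pi / 2))%:E)
      (fun s => (K * Num.sqrt b * (Num.sqrt s)^-1)%:E)) => //.
      apply: (@integrableS _ _ _ mu D) => //.
      exact: (@bounded_integrable_itv _ _ _ `|K * (1 + pi / 2)| (cst (K * (1 + pi / 2)))).
    have := @integrableZl _ _ _ mu _ mD (K * Num.sqrt b) _ irsqrt.
    by apply: integrableS.
  - move=> n s; rewrite /= in_itv/= => sb; rewrite normrM.
    have := ker_bound n sb; have := PhiK s => h1 h2.
    rewrite -mulrA -mulrDr ler_pM//.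
by rewrite (cvg_unique _ L1 L2)// RintegralZl.
Qed.

End marchaud.

(** * The fractional pairing against piecewise linear functions *)

Section ramps.
Context {R : realType}.
Notation mu := (@lebesgue_measure R).
Implicit Types (g : R -> R) (b s u r : R).

(** The right fractional derivative of order [1/2] of [g - g t], without its factor
    [1/Gamma(1/2)]. *)
Definition weyl (t : R) g s : R := (g s - g t) / Num.sqrt (t - s) +
  2^-1 * \int[mu]_(u in `[s, t]) ((g s - g u) * rm32 (u - s)).

Lemma integral_rsqrt (c : R) : 0 <= c ->
  (\int[mu]_(r in `[0%R, c]) (r * rm32 r)%:E = (2 * Num.sqrt c)%:E)%E.
Proof.
move=> c0; have h : 2 * Num.sqrt c = c `^ 2^-1 / 2^-1.
  by rewrite powR12_sqrt// invrK mulrC.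
rewrite h -integral_powR// ?invr_gt0//; apply: eq_integral => r.
rewrite inE/= in_itv/= => /andP[r0 _]; congr EFin.
have [->|rn0] := eqVneq r 0.
  by rewrite mul0r powR0//; lra.
have r0' : 0 < r by rewrite lt_neqAle eq_sym rn0.
have -> : 2^-1 - 1 = - 2^-1 :> R by field.
rewrite powRN powR12_sqrt// /rm32; field; rewrite gt_eqF ?sqrtr_gt0//=; lra.
Qed.

Lemma integral_min_rm32 (c a : R) : 0 < c -> c <= a ->
  (\int[mu]_(r in `[0%R, a]) (Num.min r c * rm32 r)%:E =
   (2 * Num.sqrt c + c * (2 * ((Num.sqrt c)^-1 - (Num.sqrt a)^-1)))%:E)%E.
Proof.
move=> c0 ca.
have mm D : measurable_fun D (fun r => (Num.min r c * rm32 r)%:E).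
  apply/measurable_EFinP; apply: measurable_funM; last exact: measurable_rm32.
  exact: measurable_minr.
have m0 r : 0 <= r -> (0 <= (Num.min r c * rm32 r)%:E)%E.
  by move=> r0; rewrite lee_fin mulr_ge0 ?rm32_ge0// le_min r0 ltW.
rewrite (@itv_bndbnd_setU _ _ _ (BRight c)); [|by rewrite bnd_simp ltW|by rewrite bnd_simp].
rewrite ge0_integral_setU//; last 3 first.
- exact: mm.
- by move=> x []; rewrite /= in_itv/= => h; apply: m0; lra.
- by apply/disj_setPS => x [] /=; rewrite !in_itv/=; lra.
rewrite EFinD; congr (_ + _)%E.
  rewrite -integral_rsqrt ?ltW//; apply: eq_integral => r.
  by rewrite inE/= in_itv/= => /andP[_ rc]; rewrite min_l.
rewrite EFinM -integral_rm32// -ge0_integralZl//; last 3 first.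
- by apply/measurable_EFinP; exact: measurable_rm32.
- by move=> r _; rewrite lee_fin rm32_ge0.
- by rewrite lee_fin ltW.
rewrite -[RHS]integral_itv_obnd_cbnd; last first.
  apply/measurable_EFinP; apply: measurable_funM => //; exact: measurable_rm32.
apply: eq_integral => r; rewrite inE/= in_itv/= => /andP[cr _].
by rewrite min_r// ltW.
Qed.

(** Beyond [b] the ramp is constant. Before [b], the integral of
    [min(u - s, b - s) (u - s)^(-3/2)] contributes twice [2 sqrt(b - s)] minus
    [2 (b - s)/sqrt(t - s)]; half of the latter cancels the boundary term. *)
Lemma weyl_ramp (t b s : R) : 0 <= b <= t -> 0 <= s <= t ->
  mu.-integrable `[s, t] (EFin \o (fun u => (Num.min s b - Num.min u b) * rm32 (u - s))) /\
  weyl t (fun u => Num.min u b) s = - 2 * Num.sqrt (b - s).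
Proof.
move=> bt st; have [bs|sb] := leP b s.
  have E u : u \in `[s, t]%classic -> (b - Num.min u b) * rm32 (u - s) = 0.
    rewrite inE/= in_itv/= => us; rewrite min_r ?subrr ?mul0r//; lra.
  rewrite /weyl (min_r bs) (@ler0_sqrtr _ (b - s)) ?subr_le0// mulr0; split.
    apply: (eq_integrable _ (cst 0%E)) => //; last exact: integrable0.
    by move=> u us /=; rewrite E.
  rewrite (min_r (_ : b <= t)); last lra.
  rewrite subrr mul0r add0r; under eq_Rintegral do rewrite E//.
  by rewrite Rintegral_cst//= mul0r mulr0.
have I : (\int[mu]_(u in `[s, t]) ((Num.min u b - s) * rm32 (u - s))%:E =
   (2 * Num.sqrt (b - s) + (b - s) * (2 * ((Num.sqrt (b - s))^-1 - (Num.sqrt (t - s))^-1)))%:E)%E.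
  rewrite -integral_min_rm32; [|lra|lra].
  rewrite -(@ge0_integral_shift _ s t (fun r => (Num.min r (b - s) * rm32 r)%:E)).
  - apply: eq_integral => u _; congr (_ * _)%:E.
    by rewrite -addr_minl.
  - apply/measurable_EFinP; apply: measurable_funM; last exact: measurable_rm32.
    exact: measurable_minr.
  - move=> r; rewrite lee_fin; have [r0|r0] := leP r 0; first by rewrite rm32_le0 ?mulr0.
    by rewrite mulr_ge0 ?rm32_ge0// le_min ltW//= subr_ge0 ltW.
have mF : measurable_fun `[s, t] (fun u => (Num.min u b - s) * rm32 (u - s)).
  apply: measurable_funTS; apply: measurable_funM.
    by apply: measurable_funB => //; exact: measurable_minr.
  by apply: (measurableT_comp (@measurable_rm32 _ setT)); exact: measurable_funB.
have iF : mu.-integrable `[s, t] (EFin \o (fun u => (Num.min u b - s) * rm32 (u - s))).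
  apply/integrableP; split; first exact/measurable_EFinP.
  have -> : (\int[mu]_(u in `[s, t]) `|(EFin \o (fun u => (Num.min u b - s)%R * rm32 (u - s))%R) u| =
    \int[mu]_(u in `[s, t]) ((Num.min u b - s) * rm32 (u - s))%:E)%E.
    apply: eq_integral => u; rewrite inE/= in_itv/= => /andP[su _].
    by rewrite ger0_norm// mulr_ge0 ?rm32_ge0// subr_ge0 le_min su ltW.
  by rewrite I ltry.
have E : (fun u => (s - Num.min u b) * rm32 (u - s)) =
    (fun u => - 1 * ((Num.min u b - s) * rm32 (u - s))).
  by apply/funext => u; ring.
split; first by rewrite E; exact: (@integrableZl _ _ _ mu _ (measurable_itv _) (-1) _ iF).
rewrite /weyl (min_l (ltW sb)) E RintegralZl//= /Rintegral I/= (min_r (_ : b <= t)); last lra.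
have bs0 : 0 < Num.sqrt (b - s) by rewrite sqrtr_gt0 subr_gt0.
have ts0 : 0 < Num.sqrt (t - s) by rewrite sqrtr_gt0 subr_gt0; lra.
have bsE : Num.sqrt (b - s) ^+ 2 = b - s by rewrite sqr_sqrtr// subr_ge0 ltW.
rewrite -opprB; move: bsE bs0 ts0.
move: (Num.sqrt (b - s)) (Num.sqrt (t - s)) => p q <- p0 q0.
by field; rewrite !gt_eqF.
Qed.

Lemma measurable_gagliardo (Phi : R -> R) : measurable_fun setT Phi ->
  measurable_fun setT
    (fun s => \int[mu]_(u in `[0%R, s]) (`|Phi u - Phi s| * rm32 (s - u))%:E)%E.
Proof.
move=> mPhi.
pose k (z : measurableTypeR R * measurableTypeR R) :=
  (\1_`[0, +oo[%classic z.2 * (`|Phi z.2 - Phi z.1| * rm32 (z.1 - z.2)))%:E.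
have -> : (fun s => \int[mu]_(u in `[0%R, s]) (`|Phi u - Phi s| * rm32 (s - u))%:E)%E =
    (fun s => \int[mu]_u k (s, u))%E.
  apply/funext => s; apply: eq_integral_support => //= u.
    by rewrite in_itv/= => us _; rewrite /k/= indicE mem_set ?mul1r//= in_itv/=; lra.
  move=> _; rewrite in_itv/= /k/= => /negP us.
  have [u0|u0] := ltP u 0.
    by rewrite indicE memNset ?mul0r//= in_itv/= andbT; lra.
  by rewrite rm32_le0 ?mulr0//; lra.
apply: (measurable_fun_fubini_tonelli_F k); last first.
  by move=> z; rewrite lee_fin !mulr_ge0 ?rm32_ge0.
apply/measurable_EFinP; apply: measurable_funM.
  have h := @measurable_indic _ (measurableTypeR R) R setT _ (measurable_itv `[0, +oo[).
  exact: (measurableT_comp h measurable_snd).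
apply: measurable_funM.
  apply: measurableT_comp => //; apply: measurable_funB.
    exact: (measurableT_comp mPhi measurable_snd).
  exact: (measurableT_comp mPhi measurable_fst).
by apply: (measurableT_comp (@measurable_rm32 _ setT)); exact: measurable_funB.
Qed.

Section pairing.
Variables (Phi : R -> R) (K t : R).
Hypotheses (t0 : 0 < t) (mPhi : measurable_fun setT Phi)
  (PhiK : forall s, `|Phi s| <= K).
Hypothesis Phifin : (\int[mu]_(s in `[0%R, t]) \int[mu]_(u in `[0%R, s])
   (`|Phi u - Phi s| * rm32 (s - u))%:E < +oo)%E.

Let A := marchaud Phi.

Let iA : mu.-integrable `[0, t] (EFin \o A).
Proof. exact: integrable_marchaud mPhi PhiK Phifin. Qed.

(** The number [l] is the integral of [Phi] against [g] over [[0, t]]: the factor [pi] is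
    [Gamma(1/2)^2]. The integrability conditions make the relation linear in [g]. *)
Definition gls_pairing g (l : R) :=
  [/\ forall s, 0 <= s <= t ->
       mu.-integrable `[s, t] (EFin \o (fun u => (g s - g u) * rm32 (u - s))),
     mu.-integrable `[0, t] (EFin \o (fun s => marchaud Phi s * weyl t g s)) &
     \int[mu]_(s in `[0, t]) (marchaud Phi s * weyl t g s) = - pi * l].

Lemma gls_pairing_cst c : gls_pairing (fun=> c) 0.
Proof.
have W s : weyl t (fun=> c) s = 0.
  rewrite /weyl subrr mul0r add0r.
  by under eq_Rintegral do rewrite mul0r; rewrite Rintegral_cst//= mul0r mulr0.
have E : (fun s => marchaud Phi s * weyl t (fun=> c) s) = cst 0.
  by apply/funext => s; rewrite W mulr0.
split.
- move=> s _; rewrite (_ : (fun u => _) = cst 0); first exact: integrable0.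
  by apply/funext => u; rewrite subrr mul0r.
- by rewrite E; exact: integrable0.
- by rewrite E Rintegral_cst//= mul0r mulr0.
Qed.

Lemma gls_pairing_lin g g' l l' c : gls_pairing g l -> gls_pairing g' l' ->
  gls_pairing (fun s => g s + c * g' s) (l + c * l').
Proof.
move=> [i1 i2 i3] [j1 j2 j3].
have E s : (fun u => (g s + c * g' s - (g u + c * g' u)) * rm32 (u - s)) =
   (fun u => (g s - g u) * rm32 (u - s) + c * ((g' s - g' u) * rm32 (u - s))).
  by apply/funext => u; ring.
have cj s : 0 <= s <= t -> mu.-integrable `[s, t] (EFin \o (fun u => c * ((g' s - g' u) * rm32 (u - s)))).
  by move=> st; exact: (@integrableZl _ _ _ mu _ (measurable_itv _) c _ (j1 s st)).
have W s : 0 <= s <= t ->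
   weyl t (fun s => g s + c * g' s) s = weyl t g s + c * weyl t g' s.
  move=> st; rewrite /weyl E RintegralD//; [|exact: i1|exact: cj].
  by rewrite RintegralZl//; [ring|exact: j1].
have cA : mu.-integrable `[0, t] (EFin \o (fun s => c * (marchaud Phi s * weyl t g' s))).
  exact: (@integrableZl _ _ _ mu _ (measurable_itv _) c _ j2).
have EA s : s \in `[0, t]%classic ->
    marchaud Phi s * weyl t g s + c * (marchaud Phi s * weyl t g' s) =
    marchaud Phi s * weyl t (fun s => g s + c * g' s) s.
  by rewrite inE/= in_itv/= => st; rewrite W//; ring.
split.
- by move=> s st; rewrite E; exact: (@integrableD _ _ _ mu _ (measurable_itv _) _ _ (i1 s st) (cj s st)).
- apply: eq_integrable (@integrableD _ _ _ mu _ (measurable_itv _) _ _ i2 cA) => //.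
  by move=> s st /=; rewrite -EFinD EA.
- under eq_Rintegral do rewrite -EA//.
  by rewrite RintegralD// RintegralZl// i3 j3; ring.
Qed.

Let Phifin_le b : b <= t -> (\int[mu]_(s in `[0%R, b]) \int[mu]_(u in `[0%R, s])
   (`|Phi u - Phi s| * rm32 (s - u))%:E < +oo)%E.
Proof.
move=> bt; apply: le_lt_trans Phifin; apply: ge0_subset_integral => //.
- apply: measurable_funTS; exact: measurable_gagliardo.
- by move=> s _; apply: integral_ge0 => u _; rewrite lee_fin mulr_ge0 ?rm32_ge0.
- by apply: subset_itvl; rewrite bnd_simp.
Qed.

(** A ramp is the primitive of the indicator of [[0, b]], so the integral against it is
    the ordinary integral of [Phi] over [[0, b]]; here this comes from [marchaud_abel]. *)
Lemma gls_pairing_ramp b : 0 <= b <= t ->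
  gls_pairing (fun u => Num.min u b) (\int[mu]_(s in `[0, b]) Phi s).
Proof.
move=> bt.
have msq D : measurable_fun D (fun s => Num.sqrt (b - s)).
  by apply: measurable_funTS; apply: (measurableT_comp (@measurable_sqrt _ setT)); exact: measurable_funB.
have i0 : mu.-integrable `[0, t] (EFin \o (fun s => A s * Num.sqrt (b - s))).
  apply: (@le_integrable_EFin R _ (measurableTypeR R) mu _ _ (fun s => Num.sqrt t * `|A s|)) => //.
  - apply: measurable_funM; last exact: msq.
    exact: ((measurable_EFinP _ _).1 (measurable_int mu iA)).
  - move=> s; rewrite /= in_itv/= => st; rewrite normrM mulrC ler_wpM2r//.
    rewrite ger0_norm ?sqrtr_ge0// ler_wsqrtr//; lra.
  - exact: (@integrableZl _ _ _ mu _ (measurable_itv _) (Num.sqrt t) _ (integrable_norm iA)).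
have i1 : mu.-integrable `[0, t] (EFin \o (fun s => - 2 * (A s * Num.sqrt (b - s)))).
  exact: (@integrableZl _ _ _ mu _ (measurable_itv _) (-2) _ i0).
have EA s : s \in `[0, t]%classic -> - 2 * (A s * Num.sqrt (b - s)) =
    A s * weyl t (fun u => Num.min u b) s.
  by rewrite inE/= in_itv/= => st; rewrite (weyl_ramp bt st).2; ring.
split.
- by move=> s st; exact: (weyl_ramp bt st).1.
- by apply: eq_integrable i1 => // s st /=; rewrite EA.
- under eq_Rintegral do rewrite -EA//.
  rewrite RintegralZl//.
  have -> : \int[mu]_(s in `[0, t]) (A s * Num.sqrt (b - s)) =
      \int[mu]_(s in `[0, b]) (A s * Num.sqrt (b - s)).
    rewrite /Rintegral; congr fine; apply: eq_integral_support => //= s; rewrite !in_itv/= => h /negP h'.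
      by rewrite ler0_sqrtr ?mulr0//; lra.
    by exfalso; lra.
  move: (bt) => /andP[]; rewrite le_eqVlt => /predU1P[<- _|b0 btt].
    by rewrite set_itv1 !Rintegral_set1 !mulr0.
  by rewrite (marchaud_abel b0 mPhi PhiK (Phifin_le btt)); field.
Qed.

End pairing.
End ramps.

(** * Hölder paths as limits of their interpolations *)

Section holder_kernels.
Context {R : realType}.
Notation mu := (@lebesgue_measure R).
Implicit Types (r s u : R) (g : R -> R).
Variable alpha : R.
Hypothesis alphaP : 2^-1 < alpha <= 1.

Let alpha0 : alpha != 0. Proof. by rewrite gt_eqF//; (move: alphaP; lra). Qed.
Let alpha1 : alpha - 2^-1 != 0. Proof. by rewrite gt_eqF//; (move: alphaP; lra). Qed.
Let alpha2 : alpha - 2^-1 - 1 != 0. Proof. by rewrite lt_eqF//; (move: alphaP; lra). Qed.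

Lemma powR_sqrt r : 0 <= r -> r `^ alpha / Num.sqrt r = r `^ (alpha - 2^-1).
Proof.
rewrite le_eqVlt => /predU1P[<-|r0].
  by rewrite !powR0 ?mul0r.
rewrite powRB; last by rewrite (gt_eqF r0) implybT.
by rewrite powR12_sqrt// ltW.
Qed.

Lemma powR_rm32 r : 0 <= r -> r `^ alpha * rm32 r = r `^ (alpha - 2^-1 - 1).
Proof.
rewrite le_eqVlt => /predU1P[<-|r0].
  by rewrite !powR0 ?mul0r.
rewrite powRB; last by rewrite (gt_eqF r0) implybT.
by rewrite -powR_sqrt ?ltW// powRr1 ?ltW// /rm32 invfM -mulrA [_^-1 * r^-1]mulrC.
Qed.

Lemma integral_holder_rm32 (s t : R) : s <= t ->
  (\int[mu]_(u in `[s, t]) (`|u - s| `^ alpha * rm32 (u - s))%:E =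
    ((t - s) `^ (alpha - 2^-1) / (alpha - 2^-1))%:E)%E.
Proof.
move=> st.
transitivity (\int[mu]_(u in `[s, t]) ((u - s) `^ (alpha - 2^-1 - 1))%:E)%E.
  apply: eq_integral => u; rewrite inE/= in_itv/= => us.
  by rewrite ger0_norm ?powR_rm32//; (move: alphaP; lra).
rewrite (@ge0_integral_shift _ s t (fun r => (r `^ (alpha - 2^-1 - 1))%:E)).
- by rewrite integral_powR ?subr_ge0 ?subr_gt0//; (move: alphaP; lra).
- by apply/measurable_EFinP; exact: measurable_powR.
- by move=> r; rewrite lee_fin powR_ge0.
Qed.

Lemma integrable_holder_rm32 (C s t : R) : s <= t ->
  mu.-integrable `[s, t] (EFin \o (fun u => C * (`|u - s| `^ alpha * rm32 (u - s)))).
Proof.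
move=> st; apply: (@integrableZl _ _ _ mu _ (measurable_itv _) C
  (fun u => (`|u - s| `^ alpha * rm32 (u - s))%:E)).
apply/integrableP; split.
  apply/measurable_EFinP; apply: measurable_funTS; apply: measurable_funM.
    apply: (measurableT_comp (measurable_powR alpha)).
    by apply: measurableT_comp => //; exact: measurable_funB.
  by apply: (measurableT_comp (@measurable_rm32 _ setT)); exact: measurable_funB.
under eq_integral do rewrite gee0_abs ?lee_fin ?mulr_ge0 ?powR_ge0 ?rm32_ge0//.
by rewrite integral_holder_rm32 ?ltry.
Qed.

Variables (C t : R).
Hypotheses (C0 : 0 <= C) (t0 : 0 < t).

(** A Hölder condition with an explicit constant, so that bounds can be uniform over a
    family of functions. *)
Definition holder_on (g : R -> R) := forall s u, 0 <= s <= t -> 0 <= u <= t ->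
  `|g u - g s| <= C * `|u - s| `^ alpha.

Let kbound g s u : holder_on g -> 0 <= s <= t -> s <= u <= t ->
  `|(g s - g u) * rm32 (u - s)| <= C * (`|u - s| `^ alpha * rm32 (u - s)).
Proof.
move=> hg st su; rewrite normrM (ger0_norm (rm32_ge0 _)) mulrA ler_wpM2r ?rm32_ge0//.
by rewrite distrC hg//; (move: alphaP C0 t0; lra).
Qed.

Let mk g s : measurable_fun setT g -> measurable_fun `[s, t] (fun u => (g s - g u) * rm32 (u - s)).
Proof.
move=> mg; apply: measurable_funTS; apply: measurable_funM; first exact: measurable_funB.
by apply: (measurableT_comp (@measurable_rm32 _ setT)); exact: measurable_funB.
Qed.

Lemma integrable_weyl g s : measurable_fun setT g -> holder_on g -> 0 <= s <= t ->
  mu.-integrable `[s, t] (EFin \o (fun u => (g s - g u) * rm32 (u - s))).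
Proof.
move=> mg hg st.
apply: (@le_integrable_EFin R _ (measurableTypeR R) mu _ _
  (fun u => C * (`|u - s| `^ alpha * rm32 (u - s)))) => //.
- exact: mk.
- by move=> u; rewrite /= in_itv/= => su; exact: kbound.
- by apply: integrable_holder_rm32; (move: alphaP C0 t0; lra).
Qed.

Lemma weyl_bound g s : measurable_fun setT g -> holder_on g -> 0 <= s <= t ->
  `|weyl t g s| <= C * (t `^ (alpha - 2^-1) * (1 + 2^-1 / (alpha - 2^-1))).
Proof.
move=> mg hg st; have st' : s <= t by (move: alphaP C0 t0; lra).
have tt : (t - s) `^ (alpha - 2^-1) <= t `^ (alpha - 2^-1).
  by apply: ge0_ler_powR; rewrite ?nnegrE; (move: alphaP C0 t0; lra).
have b1 : `|(g s - g t) / Num.sqrt (t - s)| <= C * t `^ (alpha - 2^-1).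
  rewrite normrM (ger0_norm (_ : 0 <= (Num.sqrt (t - s))^-1)) ?invr_ge0 ?sqrtr_ge0//.
  apply: (@le_trans _ _ (C * ((t - s) `^ alpha / Num.sqrt (t - s)))).
    rewrite mulrA ler_wpM2r ?invr_ge0 ?sqrtr_ge0// distrC.
    have := hg s t st; rewrite (ger0_norm (_ : 0 <= t - s)) ?subr_ge0//; apply; (move: alphaP C0 t0; lra).
  by rewrite powR_sqrt ?subr_ge0// ler_wpM2l.
have b2 : `|\int[mu]_(u in `[s, t]) ((g s - g u) * rm32 (u - s))| <=
   C * (t `^ (alpha - 2^-1) / (alpha - 2^-1)).
  have iw := integrable_weyl mg hg st.
  apply: (le_trans (le_normr_Rintegral _ iw)) => //.
  apply: (@le_trans _ _ (\int[mu]_(u in `[s, t]) (C * (`|u - s| `^ alpha * rm32 (u - s))))).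
    apply: le_Rintegral => //.
    - exact: (integrable_norm iw).
    - exact: integrable_holder_rm32.
    - by move=> u; rewrite /= in_itv/= => su; exact: kbound.
  have i1 : mu.-integrable `[s, t] (EFin \o (fun u => `|u - s| `^ alpha * rm32 (u - s))).
    have := integrable_holder_rm32 1 st'; apply: eq_integrable => // u _ /=.
    by rewrite mul1r.
  rewrite RintegralZl// ler_wpM2l// /Rintegral integral_holder_rm32//= ler_wpM2r// invr_ge0.
  by move: alphaP C0 t0; lra.
have := ler_normD ((g s - g t) / Num.sqrt (t - s))
  (2^-1 * \int[mu]_(u in `[s, t]) ((g s - g u) * rm32 (u - s))).
rewrite -/(weyl t g s) [`|2^-1 * _|]normrM (ger0_norm (_ : 0 <= 2^-1)) ?invr_ge0//.
move: b1 b2; rewrite mulrDr mulr1 mulrDr.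
set a := C * t `^ _. set c := C * (_ / _).
have -> : C * (t `^ (alpha - 2^-1) * (2^-1 / (alpha - 2^-1))) = 2^-1 * c by rewrite /c; ring.
(move: alphaP C0 t0; lra).
Qed.

Lemma cvg_weyl (g_ : nat -> R -> R) g s :
  (forall n, measurable_fun setT (g_ n)) -> measurable_fun setT g ->
  (forall n, holder_on (g_ n)) ->
  (forall u, 0 <= u <= t -> g_ n u @[n --> \oo] --> g u) -> 0 <= s <= t ->
  weyl t (g_ n) s @[n --> \oo] --> weyl t g s.
Proof.
move=> mg_ mg hg_ gg st; have st' : s <= t by (move: alphaP C0 t0; lra).
apply: cvgD.
  by apply: cvgMr_tmp; apply: cvgB; apply: gg; (move: alphaP C0 t0; lra).
apply: cvgMl_tmp.
have dom := @Rintegral_dominated_cvg R _ (measurableTypeR R) mu `[s, t]%classic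
   (fun n u => (g_ n s - g_ n u) * rm32 (u - s)) (fun u => (g s - g u) * rm32 (u - s))
   (fun u => C * (`|u - s| `^ alpha * rm32 (u - s))).
apply: (dom _ _ _ _ _ _).2 => //.
- by move=> n; exact: mk.
- exact: mk.
- apply: aeW => u; rewrite /= in_itv/= => su.
  by apply: cvgMr_tmp; apply: cvgB; apply: gg; (move: alphaP C0 t0; lra).
- exact: integrable_holder_rm32.
- by move=> n u; rewrite /= in_itv/= => su; exact: kbound.
Qed.

End holder_kernels.

Section interpolation.
Context {R : realType}.
Notation mu := (@lebesgue_measure R).
Implicit Types (s u v : R) (n i j k : nat).
Variables (alpha C t : R) (x : R -> R).
Hypotheses (alphaP : 2^-1 < alpha <= 1) (C0 : 0 <= C) (t0 : 0 < t).
Hypothesis hx : holder_on alpha C t x.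

Definition mesh (n : nat) : R := t / n.+1%:R.
Definition node (n i : nat) : R := i%:R * mesh n.
Definition slope (n i : nat) : R := (x (node n i.+1) - x (node n i)) / mesh n.
(** Interpolation is expressed by ramps: the increment of [min(s, node (i+1)) - min(s, node i)]
    is carried by the [i]-th cell, so [interp] is an affine combination of ramps and its
    pairing with [Phi] is computed by linearity. Induction goes through [interp_upto],
    which follows the path on the first [k] cells and is constant afterwards. *)
Definition interp_upto (n k : nat) (s : R) : R :=
  x 0 + \sum_(i < k) slope n i * (Num.min s (node n i.+1) - Num.min s (node n i)).
Definition interp n := interp_upto n n.+1.

Lemma mesh_gt0 n : 0 < mesh n. Proof. by rewrite divr_gt0. Qed.

Lemma mesh_mul n : mesh n `^ (alpha - 1) * mesh n = mesh n `^ alpha.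
Proof.
rewrite mulrC mulr_powRB1//; first exact: ltW (mesh_gt0 n).
by move: alphaP; lra.
Qed.

Lemma nodeS n i : node n i.+1 = node n i + mesh n.
Proof. by rewrite /node -natr1 mulrDl mul1r. Qed.

Lemma node0 n : node n 0 = 0. Proof. by rewrite /node mul0r. Qed.

Lemma node_last n : node n n.+1 = t.
Proof. by rewrite /node /mesh mulrC divfK. Qed.

Lemma le_node n i j : (i <= j)%N -> node n i <= node n j.
Proof. by move=> ij; rewrite ler_wpM2r ?(ltW (mesh_gt0 n))// ler_nat. Qed.

Lemma node_itv n i : (i <= n.+1)%N -> 0 <= node n i <= t.
Proof. by move=> i_n; apply/andP; split; [rewrite -(node0 n)|rewrite -(node_last n)]; exact: le_node. Qed.

Lemma slope_bound n i : (i <= n)%N -> `|slope n i| <= C * mesh n `^ (alpha - 1).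
Proof.
move=> i_n; have m0 := mesh_gt0 n.
rewrite normrM (gtr0_norm (_ : 0 < (mesh n)^-1)) ?invr_gt0// ler_pdivrMr//.
have := hx (node_itv (leqW i_n)) (node_itv (i_n : (i < n.+1)%N)).
rewrite {2}nodeS addrAC subrr add0r (gtr0_norm m0) => /le_trans; apply.
by rewrite -mulrA mesh_mul.
Qed.

Lemma interp_lip n s u : 0 <= s -> s <= u ->
  `|interp n u - interp n s| <= C * mesh n `^ (alpha - 1) * (u - s).
Proof.
move=> s0 su; rewrite /interp /interp_upto opprD addrACA subrr add0r -sumrB.
pose inc v i := Num.min v (node n i.+1) - Num.min v (node n i).
apply: (@le_trans _ _ (\sum_(i < n.+1) C * mesh n `^ (alpha - 1) * (inc u i - inc s i))).
  apply: (le_trans (ler_norm_sum _ _ _)); apply: ler_sum => i _.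
  rewrite -mulrBr normrM.
  have i0 : 0 <= inc u i - inc s i.
    have ii := @le_node n i i.+1 (leqnSn i); rewrite /inc /Num.min.
    by do 4 (case: ltP => ?); lra.
  by rewrite (ger0_norm i0) ler_wpM2r// slope_bound// -ltnS.
rewrite -mulr_sumr ler_wpM2l ?mulr_ge0 ?powR_ge0//.
rewrite sumrB /inc.
have T v : \sum_(i < n.+1) (Num.min v (node n i.+1) - Num.min v (node n i)) =
    Num.min v t - Num.min v 0.
  rewrite -(big_mkord xpredT (fun i => Num.min v (node n i.+1) - Num.min v (node n i))).
  by rewrite (telescope_sumr (fun i => Num.min v (node n i)))// node0 node_last.
rewrite !T (min_r s0) (min_r (le_trans s0 su)) !subr0 /Num.min.
by do 2 (case: ltP => ?); move: t0; lra.
Qed.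

Lemma interp_node n j : (j <= n.+1)%N -> interp n (node n j) = x (node n j).
Proof.
have H k : interp_upto n k (node n j) = x (node n (minn k j)).
  elim: k => [|k IH]; rewrite /interp_upto.
    by rewrite big_ord0 addr0 min0n node0.
  rewrite big_ord_recr/= addrA -/(interp_upto n k (node n j)) IH.
  have [jk|kj] := leqP j k.
    rewrite !min_l ?le_node// ?leqW// subrr mulr0 addr0.
    by rewrite (minn_idPr (leqW jk)).
  rewrite !min_r ?le_node// ?(ltnW kj)// (minn_idPl kj).
  rewrite [X in _ * (X - _)]nodeS [_ + mesh n - _]addrAC subrr add0r.
  by rewrite /slope divfK ?gt_eqF ?mesh_gt0// addrC subrK.
by move=> jn; rewrite /interp H (minn_idPr jn).
Qed.

Lemma interp_dist n s : 0 <= s <= t -> `|interp n s - x s| <= 2 * C * mesh n `^ alpha.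
Proof.
move=> st; have m0 := mesh_gt0 n.
pose j := Num.truncn (s / mesh n).
have sm0 : 0 <= s / mesh n by rewrite divr_ge0//; (move: alphaP C0 t0; lra).
have [j1 j2] := andP (truncn_itv sm0).
have js : node n j <= s by rewrite /node -ler_pdivlMr.
have sj : s < node n j.+1 by rewrite /node -ltr_pdivrMr.
have jn : (j <= n.+1)%N.
  rewrite -(ler_nat R) (le_trans j1)// ler_pdivrMr// -/(node n n.+1) node_last; (move: alphaP C0 t0; lra).
have d : s - node n j <= mesh n by move: sj; rewrite nodeS; (move: alphaP C0 t0; lra).
have -> : interp n s - x s = (interp n s - interp n (node n j)) + (x (node n j) - x s).
  by rewrite interp_node//; ring.
apply: (le_trans (ler_normD _ _)).
rewrite (_ : 2 * C * mesh n `^ alpha = C * mesh n `^ alpha + C * mesh n `^ alpha); last by ring.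
apply: lerD.
  apply: (le_trans (interp_lip _ _ _)) => //; first by have := node_itv jn; (move: alphaP C0 t0; lra).
  by rewrite -mesh_mul -mulrA ler_wpM2l// ler_wpM2l ?powR_ge0.
apply: (le_trans (hx st (node_itv jn))).
rewrite ler_wpM2l//; apply: ge0_ler_powR; rewrite ?nnegrE ?(ltW m0)//.
  by move: alphaP; lra.
by rewrite ler_norml; move: js d; lra.
Qed.

(** Below the mesh size the slope bound [C mesh^(alpha - 1)] suffices, as [alpha <= 1].
    Above it the increment is that of [x] up to two interpolation errors [2 C mesh^alpha]
    of [interp_dist], whence [5 = 2 + 1 + 2]. *)
Lemma interp_holder n : holder_on alpha (5 * C) t (interp n).
Proof.
have m0 := mesh_gt0 n.
suff H s u : 0 <= s <= t -> 0 <= u <= t -> s <= u ->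
    `|interp n u - interp n s| <= 5 * C * `|u - s| `^ alpha.
  move=> s u st ut; have [su|us] := leP s u; first exact: H.
  by rewrite distrC (distrC u); apply: H => //; exact: ltW.
move=> st ut su; have us0 : 0 <= u - s by (move: alphaP C0 t0; lra).
rewrite (ger0_norm us0).
have [h|h] := leP (u - s) (mesh n).
  have s0 : 0 <= s by (move: alphaP C0 t0; lra).
  apply: (le_trans (interp_lip _ s0 su)).
  have [->|usn0] := eqVneq (u - s) 0; first by rewrite mulr0 mulr_ge0 ?powR_ge0// mulr_ge0.
  apply: (@le_trans _ _ (C * (u - s) `^ alpha)); last first.
    by rewrite ler_wpM2r ?powR_ge0//; (move: alphaP C0 t0; lra).
  rewrite -mulrA ler_wpM2l//.
  have E : u - s = (u - s) `^ alpha * (u - s) `^ (1 - alpha).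
    rewrite -powRD; last by rewrite usn0 implybT.
    by rewrite addrCA subrr addr0 powRr1.
  rewrite {1}E mulrCA ger_pMr; last by rewrite powR_gt0// lt_neqAle eq_sym usn0.
  apply: (@le_trans _ _ (mesh n `^ (alpha - 1) * mesh n `^ (1 - alpha))).
    by rewrite ler_wpM2l ?powR_ge0// ge0_ler_powR ?nnegrE ?(ltW m0)//; (move: alphaP C0 t0; lra).
  rewrite -powRD; last by rewrite (gt_eqF m0) implybT.
  by rewrite addrA subrK subrr powRr0.
have mu_ : mesh n `^ alpha <= (u - s) `^ alpha.
  by rewrite ge0_ler_powR ?nnegrE ?(ltW m0)//; (move: alphaP C0 t0; lra).
have -> : interp n u - interp n s = (interp n u - x u) + (x u - x s) - (interp n s - x s) by ring.
apply: (le_trans (ler_normB _ _)).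
have := ler_normD (interp n u - x u) (x u - x s).
have := interp_dist n ut; have := interp_dist n st; have := hx st ut.
rewrite (ger0_norm us0).
have : C * mesh n `^ alpha <= C * (u - s) `^ alpha by rewrite ler_wpM2l.
(move: alphaP C0 t0; lra).
Qed.

Lemma measurable_interp n D : measurable_fun D (interp n).
Proof.
apply: measurable_funTS; rewrite /interp /interp_upto.
apply: measurable_funD => //; apply: measurable_sum => i.
by apply: measurable_funM => //; apply: measurable_funB; exact: measurable_minr.
Qed.

Lemma cvg_mesh_powR g : 0 < g -> mesh n `^ g @[n --> \oo] --> 0.
Proof.
move=> g0.
apply: ((cvg_at_rightP _ _ _).1 (powR_cvg0 g0)); split; first exact: mesh_gt0.
rewrite -[X in _ --> X](mulr0 t); apply: cvgMl_tmp; exact: cvg_harmonic.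
Qed.

Lemma cvg_interp s : 0 <= s <= t -> interp n s @[n --> \oo] --> x s.
Proof.
move=> st; pose e n := 2 * C * mesh n `^ alpha.
have e0 : e n @[n --> \oo] --> 0.
  by rewrite -(mulr0 (2 * C)); apply: cvgMl_tmp; apply: cvg_mesh_powR; (move: alphaP C0 t0; lra).
apply: (@squeeze_cvgr _ _ _ _ (fun n => x s - e n) (fun n => x s + e n)).
- by apply: nearW => n; have := interp_dist n st; rewrite ler_norml -/(e n); (move: alphaP C0 t0; lra).
- by rewrite -[X in _ --> X]subr0; apply: cvgB => //; exact: cvg_cst.
- by rewrite -[X in _ --> X]addr0; apply: cvgD => //; exact: cvg_cst.
Qed.

Section limit.
Variables (Phi : R -> R) (K : R).
Hypotheses (mPhi : measurable_fun setT Phi) (PhiK : forall s, `|Phi s| <= K).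
Hypothesis Phifin : (\int[mu]_(s in `[0%R, t]) \int[mu]_(u in `[0%R, s])
   (`|Phi u - Phi s| * rm32 (s - u))%:E < +oo)%E.

(** The integral of [Phi] against the interpolation of [x], by [gls_pairing_interp]. *)
Definition riemann_sum n := \sum_(i < n.+1) slope n i *
  (\int[mu]_(s in `[0, node n i.+1]) Phi s - \int[mu]_(s in `[0, node n i]) Phi s).

Lemma gls_pairing_interp n : gls_pairing Phi t (interp n) (riemann_sum n).
Proof.
suff H k : (k <= n.+1)%N -> gls_pairing Phi t (interp_upto n k) (\sum_(i < k) slope n i *
  (\int[mu]_(s in `[0, node n i.+1]) Phi s - \int[mu]_(s in `[0, node n i]) Phi s)).
  exact: H.
elim: k => [_|k IH kn].
  rewrite big_ord0; have -> : interp_upto n 0 = fun=> x 0.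
    by apply/funext => s; rewrite /interp_upto big_ord0 addr0.
  exact: gls_pairing_cst.
rewrite big_ord_recr /=.
have -> : interp_upto n k.+1 = (fun s => interp_upto n k s +
    slope n k * (Num.min s (node n k.+1) + (- 1) * Num.min s (node n k))).
  by apply/funext => s; rewrite /interp_upto big_ord_recr/= addrA mulN1r.
have r1 := gls_pairing_ramp t0 mPhi PhiK Phifin (node_itv (kn : (k.+1 <= n.+1)%N)).
have r2 := gls_pairing_ramp t0 mPhi PhiK Phifin (node_itv (ltnW kn)).
rewrite -[X in slope n k * (_ - X)]mul1r -mulNr.
exact: (gls_pairing_lin (slope n k) (IH (ltnW kn)) (gls_pairing_lin (-1) r1 r2)).
Qed.

(** The right derivatives of the interpolations converge pointwise and are uniformly
    bounded, because the Hölder constants are uniform, while the left derivative of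
    [Phi] is integrable: dominated convergence applies to the pairing. *)
Lemma cvg_riemann_sum (L : R) : measurable_fun setT x ->
  riemann_sum n @[n --> \oo] --> L -> gls_pairing Phi t x L.
Proof.
move=> mx hL; pose B := 5 * C * (t `^ (alpha - 2^-1) * (1 + 2^-1 / (alpha - 2^-1))).
have C5 : 0 <= 5 * C by rewrite mulr_ge0.
have iA := integrable_marchaud t0 mPhi PhiK Phifin.
have mA : measurable_fun `[0, t] (marchaud Phi).
  exact: ((measurable_EFinP _ _).1 (measurable_int mu iA)).
have mn n : measurable_fun `[0, t] (fun s => marchaud Phi s * weyl t (interp n) s).
  have [_ i _] := gls_pairing_interp n.
  exact: ((measurable_EFinP _ _).1 (measurable_int mu i)).
have cvgn s : 0 <= s <= t -> marchaud Phi s * weyl t (interp n) s @[n --> \oo] -->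
    marchaud Phi s * weyl t x s.
  move=> st; apply: cvgMl_tmp.
  apply: (cvg_weyl alphaP C5) => //.
  - by move=> n; exact: measurable_interp.
  - exact: interp_holder.
  - exact: cvg_interp.
have mlim : measurable_fun `[0, t] (fun s => marchaud Phi s * weyl t x s).
  apply: (@measurable_fun_cvg _ _ _ _ (fun n s => marchaud Phi s * weyl t (interp n) s)) => //.
have dom := @Rintegral_dominated_cvg R _ (measurableTypeR R) mu `[0, t]%classic
   (fun n s => marchaud Phi s * weyl t (interp n) s) (fun s => marchaud Phi s * weyl t x s)
   (fun s => B * `|marchaud Phi s|).
have [iL L1] : mu.-integrable `[0, t] (EFin \o (fun s => marchaud Phi s * weyl t x s)) /\
    \int[mu]_(s in `[0, t]) (marchaud Phi s * weyl t (interp n) s) @[n --> \oo] -->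
    \int[mu]_(s in `[0, t]) (marchaud Phi s * weyl t x s).
  apply: dom => //.
  - by apply: aeW => s; rewrite /= in_itv/=; exact: cvgn.
  - exact: (@integrableZl _ _ _ mu _ (measurable_itv _) B _ (integrable_norm iA)).
  - move=> n s; rewrite /= in_itv/= => st; rewrite normrM mulrC ler_wpM2r//.
    apply: (weyl_bound alphaP C5) => //; [exact: measurable_interp|exact: interp_holder].
have E n : \int[mu]_(s in `[0, t]) (marchaud Phi s * weyl t (interp n) s) = - pi * riemann_sum n.
  by have [_ _] := gls_pairing_interp n.
have L2 : \int[mu]_(s in `[0, t]) (marchaud Phi s * weyl t (interp n) s) @[n --> \oo] --> - pi * L.
  by under eq_fun do rewrite E; apply: cvgMl_tmp.
split=> //; last by rewrite -(cvg_unique _ L1 L2).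
by move=> s st; exact: (integrable_weyl alphaP C0).
Qed.
End limit.

End interpolation.

(** * Generalized Lebesgue-Stieltjes integrals with exponent 1/2 *)

Section gls.
Context {R : realType}.
Notation mu := (@lebesgue_measure R).
Implicit Types (s t u : R).

Lemma Rintegral_itv_diff (g : R -> R) a c b : a <= c -> c <= b ->
  mu.-integrable `[a, b] (EFin \o g) ->
  \int[mu]_(s in `[a, b]) g s - \int[mu]_(s in `[a, c]) g s = \int[mu]_(s in `[c, b]) g s.
Proof.
move=> ac cb ig; rewrite Rintegral_itvB ?bnd_simp//.
apply: Rintegral_itv_obnd_cbnd; apply: integrableS ig => //.
by apply: subset_itvr; rewrite bnd_simp.
Qed.

Lemma frac_deriv_left_half (Phi : R -> R) s : 0 <= s ->
  frac_deriv_left 2^-1 Phi s = (Num.sqrt pi)^-1 * marchaud Phi s.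
Proof.
move=> s0; have h : 1 - 2^-1 = 2^-1 :> R by field.
rewrite /frac_deriv_left h Gamma_half powR12_sqrt//; congr (_ * (_ + _ * _)).
apply: eq_Rintegral => u; rewrite inE/= in_itv/= => us.
by rewrite rm32_powR ?subr_ge0//; [rewrite addrC|lra].
Qed.

Lemma frac_deriv_right_half (g : R -> R) t s : s <= t ->
  frac_deriv_right 2^-1 t g s = (Num.sqrt pi)^-1 * weyl t g s.
Proof.
move=> st; have h : 1 - 2^-1 = 2^-1 :> R by field.
rewrite /frac_deriv_right h Gamma_half powR12_sqrt ?subr_ge0//; congr (_ * (_ + _ * _)).
apply: eq_Rintegral => u; rewrite inE/= in_itv/= => us.
by rewrite rm32_powR ?subr_ge0//; [field|lra].
Qed.

Lemma gls_integral_half T (Phi x : R -> R) t (L : R) : 0 <= t ->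
  besov2 2^-1 T Phi -> besov1 2^-1 T x ->
  \int[mu]_(s in `[0, t]) (marchaud Phi s * weyl t x s) = - pi * L ->
  mu.-integrable `[0, t] (EFin \o (fun s => marchaud Phi s * weyl t x s)) ->
  is_gls_integral T Phi x t L.
Proof.
move=> t0 b2 b1 E iw; exists 2^-1.
  by rewrite invr_gt0 ltr0n/= invf_lt1// ltr1n.
have h : 1 - 2^-1 = 2^-1 :> R by field.
split; [exact: b2|by rewrite h|].
have -> : \int[mu]_(s in `[0, t]) (frac_deriv_left 2^-1 Phi s * frac_deriv_right 2^-1 t x s) =
    \int[mu]_(s in `[0, t]) (pi^-1 * (marchaud Phi s * weyl t x s)).
  apply: eq_Rintegral => s; rewrite inE/= in_itv/= => /andP[s0 st].
  rewrite frac_deriv_left_half// frac_deriv_right_half//.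
  have pp : (pi : R)^-1 = (Num.sqrt pi)^-1 * (Num.sqrt pi)^-1.
    by rewrite -invfM -expr2 sqr_sqrtr// pi_ge0.
  by rewrite pp; ring.
by rewrite RintegralZl// E mulNr mulrN opprK mulKf// gt_eqF// pi_gt0.
Qed.

(** The integral part of the norm converges because [alpha - 3/2 > -1]. *)
Lemma besov1_holder (alpha C T : R) (x : R -> R) : 2^-1 < alpha <= 1 -> 0 <= C ->
  measurable_fun setT x -> holder_on alpha C T x -> besov1 2^-1 T x.
Proof.
move=> alphaP C0 mx hx; split; first exact: measurable_funTS.
have [T0|T0] := leP T 0.
  rewrite /besov1_norm (_ : [set _ | _ in _] = set0) ?ereal_sup0 ?ltNyr//.
  by apply/seteqP; split => // y /= [[s u]/= [s0 [su uT]] _]; lra.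
set B := C * T `^ (alpha - 2^-1) + C * (T `^ (alpha - 2^-1) / (alpha - 2^-1)).
apply: (@le_lt_trans _ _ B%:E); last exact: ltry.
apply: ub_ereal_sup => _ [[s t]/= [s0 [st tT]] <-].
have tT' : (t - s) `^ (alpha - 2^-1) <= T `^ (alpha - 2^-1).
  by apply: ge0_ler_powR; rewrite ?nnegrE; lra.
have mk : measurable_fun `[s, t] (fun u => `|x u - x s| * rm32 (u - s)).
  apply: measurable_funTS; apply: measurable_funM.
    by apply: measurableT_comp => //; exact: measurable_funB.
  by apply: (measurableT_comp (@measurable_rm32 _ setT)); exact: measurable_funB.
have st0 : 0 <= t - s by lra.
rewrite /B EFinD; apply: leeD.
  rewrite lee_fin powR12_sqrt//.
  apply: (@le_trans _ _ (C * ((t - s) `^ alpha / Num.sqrt (t - s)))).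
    rewrite mulrA ler_wpM2r ?invr_ge0 ?sqrtr_ge0//.
    have := hx s t; rewrite (ger0_norm st0); apply; lra.
  by rewrite powR_sqrt// ler_wpM2l.
apply: (@le_trans _ _ (\int[mu]_(u in `[s, t]) (C * (`|u - s| `^ alpha * rm32 (u - s)))%:E)%E).
  apply: (@le_trans _ _ (\int[mu]_(u in `[s, t]) (`|x u - x s| * rm32 (u - s))%:E)%E).
    rewrite le_eqVlt; apply/orP; left; apply/eqP; apply: eq_integral => u.
    rewrite inE/= in_itv/= => su.
    by rewrite (@rm32_powR _ (u - s)) ?subr_ge0//; lra.
  apply: ge0_le_integral => //.
  - by move=> u _; rewrite lee_fin mulr_ge0 ?rm32_ge0.
  - exact/measurable_EFinP.
  - apply/measurable_EFinP; apply: measurable_funTS; apply: measurable_funM => //.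
    apply: measurable_funM.
      apply: (measurableT_comp (measurable_powR alpha)).
      by apply: measurableT_comp => //; exact: measurable_funB.
    by apply: (measurableT_comp (@measurable_rm32 _ setT)); exact: measurable_funB.
  - move=> u; rewrite /= in_itv/= => su; rewrite lee_fin mulrA ler_wpM2r ?rm32_ge0//.
    by apply: hx; lra.
under eq_integral do rewrite EFinM.
rewrite ge0_integralZl//.
- rewrite integral_holder_rm32//; last exact: ltW.
  by rewrite -EFinM lee_fin ler_wpM2l// ler_wpM2r// invr_ge0; lra.
- apply/measurable_EFinP; apply: measurable_funTS; apply: measurable_funM.
    apply: (measurableT_comp (measurable_powR alpha)).
    by apply: measurableT_comp => //; exact: measurable_funB.
  by apply: (measurableT_comp (@measurable_rm32 _ setT)); exact: measurable_funB.
- by move=> u _; rewrite lee_fin mulr_ge0 ?powR_ge0 ?rm32_ge0.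
Qed.

Lemma besov2_half T (Phi : R -> R) (K : R) : 0 < T -> measurable_fun setT Phi ->
  (forall s, `|Phi s| <= K) ->
  (\int[mu]_(s in `[0%R, T]) \int[mu]_(u in `[0%R, s])
     (`|Phi u - Phi s| * rm32 (s - u))%:E < +oo)%E ->
  besov2 2^-1 T Phi.
Proof.
move=> T0 mPhi PhiK Pfin; split; first exact: measurable_funTS.
rewrite /besov2_norm; apply: lte_add_pinfty; last first.
  apply: le_lt_trans Pfin; rewrite le_eqVlt; apply/orP; left; apply/eqP.
  apply: eq_integral => s _; apply: eq_integral => u; rewrite inE/= in_itv/= => su.
  by rewrite (@rm32_powR _ (s - u)) ?subr_ge0//; lra.
apply: (@le_lt_trans _ _ (\int[mu]_(s in `[0%R, T]) (K%:E * (s `^ (2^-1 - 1))%:E))%E).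
  apply: ge0_le_integral => //.
  - by move=> s _; rewrite lee_fin divr_ge0 ?powR_ge0.
  - apply/measurable_EFinP; apply: measurable_funTS; apply: measurable_funM.
      exact: measurableT_comp.
    exact: (measurableT_comp (@measurable_inv _ setT) (measurable_powR 2^-1)).
  - apply: emeasurable_funM => //; apply/measurable_EFinP; apply: measurable_funTS.
    exact: measurable_powR.
  - move=> s _; rewrite -EFinM lee_fin.
    have -> : 2^-1 - 1 = - 2^-1 :> R by field.
    by rewrite powRN ler_wpM2r ?invr_ge0 ?powR_ge0.
rewrite ge0_integralZl//.
- by rewrite integral_powR ?ltW// ?invr_gt0// -EFinM ltry.
- by apply/measurable_EFinP; apply: measurable_funTS; exact: measurable_powR.
- by move=> s _; rewrite lee_fin powR_ge0.
- by rewrite lee_fin (le_trans _ (PhiK 0)).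
Qed.
End gls.

(** * The chain rule along one path *)

Section chain_rule.
Context {R : realType}.
Notation mu := (@lebesgue_measure R).
Implicit Types (s t u r y z p q : R).
Variables (alpha N K : R) (V h f : R -> R).
Hypotheses (alphaP : 2^-1 < alpha <= 1) (N0 : 0 <= N).
Hypotheses (ndV : nondecreasing_fun V) (V0K : forall y, 0 <= V y <= K).
Hypotheses (mh : measurable_fun setT h) (hK : forall y, -N <= y <= N -> `|h y| <= K).
Hypothesis hV : forall y z, -N <= y -> y <= z -> z <= N -> `|h z - h y| <= V z - V y.
Hypothesis fh : forall p q, p <= q -> f q - f p = \int[mu]_(y in `[p, q]) h y.

(** A bound for the oscillation of [h] among the values that a path with Hölder constant
    [N] takes within time [r] of passing through [y]. *)
Definition osc_window y r : R := V (y + N * r `^ alpha) - V (y - N * r `^ alpha).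

Let window_ge0 r : 0 <= N * r `^ alpha. Proof. by rewrite mulr_ge0 ?powR_ge0. Qed.

Let osc_ge0 y r : 0 <= osc_window y r.
Proof. by rewrite subr_ge0; apply: ndV; have := window_ge0 r; lra. Qed.

Let osc_le y r : osc_window y r <= K.
Proof.
have := V0K (y + N * r `^ alpha); have := V0K (y - N * r `^ alpha).
by rewrite /osc_window; lra.
Qed.

Let osc_nd y r r' : 0 <= r -> r <= r' -> osc_window y r <= osc_window y r'.
Proof.
move=> r0 rr; have p : N * r `^ alpha <= N * r' `^ alpha.
  by rewrite ler_wpM2l// ge0_ler_powR ?nnegrE//; move: alphaP; lra.
rewrite /osc_window lerB//; apply: ndV; lra.
Qed.

Let h_osc y z r : -N <= y <= N -> -N <= z <= N -> `|y - z| <= N * r `^ alpha ->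
  `|h y - h z| <= osc_window z r.
Proof.
move=> yN zN; rewrite ler_norml => yz.
suff H : `|h y - h z| <= V (Num.max y z) - V (Num.min y z).
  apply: (le_trans H); rewrite /osc_window lerB//; apply: ndV.
    rewrite ge_max; lra.
  rewrite le_min; lra.
have [yz'|zy] := leP y z; last by apply: hV; lra.
by rewrite distrC; apply: hV; lra.
Qed.

Lemma measurable_osc2 : measurable_fun setT
  (fun z : measurableTypeR R * measurableTypeR R => osc_window z.1 z.2).
Proof.
have mV : measurable_fun setT V by exact: nondecreasing_measurable.
have mw : measurable_fun setT (fun z : measurableTypeR R * measurableTypeR R => N * z.2 `^ alpha).
  by apply: measurable_funM => //; exact: (measurableT_comp (measurable_powR alpha) measurable_snd).
apply: measurable_funB; apply: (measurableT_comp mV).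
  exact: measurable_funD.
exact: measurable_funB.
Qed.

Let mosc r : measurable_fun setT (osc_window ^~ r).
Proof. exact: (measurableT_comp measurable_osc2 (pair2_measurable r)). Qed.

Let mosc1 y : measurable_fun setT (osc_window y).
Proof. exact: (measurableT_comp measurable_osc2 (pair1_measurable y)). Qed.

Definition osc_energy T y : \bar R :=
  (\int[mu]_(r in `[0%R, T]) (osc_window y r * rm32 r)%:E)%E.

Lemma osc_energy_ge0 T y : (0 <= osc_energy T y)%E.
Proof. by apply: integral_ge0 => r _; rewrite lee_fin mulr_ge0 ?rm32_ge0. Qed.

Lemma measurable_osc_energy T : measurable_fun setT (osc_energy T).
Proof.
pose k (z : measurableTypeR R * measurableTypeR R) : \bar R :=
  (\1_`[0, T]%classic z.2 * (osc_window z.1 z.2 * rm32 z.2))%:E.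
have -> : osc_energy T = (fun y => \int[mu]_r k (y, r))%E.
  apply/funext => y; apply: eq_integral_support => //= r hr.
    by rewrite /k/= indicE mem_set// mul1r.
  by move=> nr; rewrite /k/= indicE memNset// mul0r.
apply: (measurable_fun_fubini_tonelli_F k); last first.
  by move=> z; rewrite lee_fin !mulr_ge0 ?rm32_ge0.
apply/measurable_EFinP; apply: measurable_funM.
  have hi := @measurable_indic _ (measurableTypeR R) R setT _ (measurable_itv `[0, T]).
  exact: (measurableT_comp hi measurable_snd).
apply: (measurable_funM measurable_osc2).
exact: (measurableT_comp (@measurable_rm32 _ setT) measurable_snd).
Qed.

Variables (T : R) (x : R -> R).
Hypotheses (T0 : 0 < T) (mx : measurable_fun setT x).
Hypotheses (hx : holder_on alpha N T x) (xN : forall s, -N <= x s <= N).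
Hypothesis Efin : (\int[mu]_(s in `[0%R, T]) osc_energy T (x s) < +oo)%E.

Let Phi s := h (x s).
Let mPhi : measurable_fun setT Phi. Proof. exact: measurableT_comp mh mx. Qed.
Let PhiK s : `|Phi s| <= K. Proof. exact: hK. Qed.

Let mE : measurable_fun setT (fun s => osc_energy T (x s)).
Proof. exact: (measurableT_comp (measurable_osc_energy T) mx). Qed.

Let mrm y D : measurable_fun D (fun r => (osc_window y r * rm32 r)%:E).
Proof.
apply: measurable_funTS; apply/measurable_EFinP.
by apply: measurable_funM; [exact: mosc1|exact: measurable_rm32].
Qed.

(** For [u <= s], [x u] lies within [N (s - u)^alpha] of [x s]. *)
Lemma gagliardo_fin t : t <= T ->
  (\int[mu]_(s in `[0%R, t]) \int[mu]_(u in `[0%R, s])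
     (`|Phi u - Phi s| * rm32 (s - u))%:E < +oo)%E.
Proof.
move=> tT; apply: le_lt_trans Efin.
apply: (@le_trans _ _ (\int[mu]_(s in `[0%R, t]) osc_energy T (x s))%E); last first.
  apply: ge0_subset_integral => //.
  - exact: measurable_funTS.
  - by move=> s _; exact: osc_energy_ge0.
  - by apply: subset_itvl; rewrite bnd_simp.
apply: ge0_le_integral => //.
- by move=> s _; apply: integral_ge0 => u _; rewrite lee_fin mulr_ge0 ?rm32_ge0.
- by apply: measurable_funTS; exact: measurable_gagliardo.
- exact: measurable_funTS.
move=> s; rewrite /= in_itv/= => st.
apply: (@le_trans _ _ (\int[mu]_(u in `[0%R, s]) (osc_window (x s) (s - u) * rm32 (s - u))%:E)%E).
  apply: ge0_le_integral => //.
  - by move=> u _; rewrite lee_fin mulr_ge0 ?rm32_ge0.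
  - apply/measurable_EFinP; apply: measurable_funTS; apply: measurable_funM.
      by apply: measurableT_comp => //; exact: measurable_funB.
    by apply: (measurableT_comp (@measurable_rm32 _ setT)); exact: measurable_funB.
  - apply/measurable_EFinP; apply: measurable_funTS; apply: measurable_funM.
      by apply: (measurableT_comp (mosc1 (x s))); exact: measurable_funB.
    by apply: (measurableT_comp (@measurable_rm32 _ setT)); exact: measurable_funB.
  - move=> u; rewrite /= in_itv/= => su; rewrite lee_fin ler_wpM2r ?rm32_ge0//.
    apply: h_osc => //; have := @hx u s; rewrite distrC (ger0_norm (_ : 0 <= s - u)) ?subr_ge0 ?(andP su).2//.
    by apply; lra.
rewrite (@ge0_integral_reflect _ s (fun r => (osc_window (x s) r * rm32 r)%:E)).
- apply: ge0_subset_integral => //.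
  + exact: mrm.
  + by move=> r _; rewrite lee_fin mulr_ge0 ?rm32_ge0.
  + by apply: subset_itvl; rewrite bnd_simp; lra.
- exact: mrm.
- by move=> r; rewrite lee_fin mulr_ge0 ?rm32_ge0.
Qed.

Let iosc a b r : mu.-integrable `[a, b] (EFin \o (fun s => osc_window (x s) r)).
Proof.
apply: (@bounded_integrable_itv _ _ _ K).
  by apply: measurable_funTS; exact: (measurableT_comp (mosc r) mx).
by move=> s _; rewrite ger0_norm.
Qed.

Let iPhi a b : mu.-integrable `[a, b] (EFin \o Phi).
Proof. by apply: (@bounded_integrable_itv _ _ _ K) => //; exact: measurable_funTS. Qed.

(** The oscillation increases with the window, so on [[r, 2r]] it is at least its value
    at [r], and the mass of [rm32] there is at least [r rm32(2r) = 1/(2 sqrt(2r))]. *)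
Let osc_window_energy y r : 0 < r -> 2 * r <= T ->
  (((2 * Num.sqrt (2 * r))^-1 * osc_window y r)%:E <= osc_energy T y)%E.
Proof.
move=> r0 rT; have r20 : 0 < 2 * r by rewrite mulr_gt0.
apply: (@le_trans _ _ (\int[mu]_(r' in `[r, (2 * r)%R]) (osc_window y r * rm32 (2 * r))%:E)%E).
  rewrite integral_cst//= lebesgue_measure_itv/= lte_fin ifT; last lra.
  rewrite -EFinD -EFinM lee_fin mulrC -mulrA ler_wpM2l//.
  rewrite /rm32 (_ : 2 * r - r = r); last by ring.
  rewrite le_eqVlt; apply/orP; left; apply/eqP; field.
  by rewrite !gt_eqF// sqrtr_gt0.
apply: (@le_trans _ _ (\int[mu]_(r' in `[r, (2 * r)%R]) (osc_window y r' * rm32 r')%:E)%E).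
  apply: ge0_le_integral => //.
  - by move=> ? _; rewrite lee_fin mulr_ge0 ?rm32_ge0.
  - exact: mrm.
  - move=> r'; rewrite /= in_itv/= => rr; rewrite lee_fin ler_pM ?rm32_ge0//.
      by apply: osc_nd; lra.
    by apply: rm32_le; lra.
apply: ge0_subset_integral => //.
- exact: mrm.
- by move=> ? _; rewrite lee_fin mulr_ge0 ?rm32_ge0.
- by move=> r'/=; rewrite !in_itv/=; lra.
Qed.

Lemma integral_osc_window t r : t <= T -> 0 < r -> 2 * r <= T ->
  \int[mu]_(s in `[0, t]) osc_window (x s) r <=
    2 * Num.sqrt (2 * r) * fine (\int[mu]_(s in `[0%R, T]) osc_energy T (x s))%E.
Proof.
move=> tT r0 rT; set E := (\int[mu]_(s in `[0%R, T]) _)%E.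
have Ef : E \is a fin_num.
  by rewrite ge0_fin_numE//; apply: integral_ge0 => s _; exact: osc_energy_ge0.
have c0 : 0 < 2 * Num.sqrt (2 * r) by rewrite mulr_gt0// sqrtr_gt0; lra.
rewrite -ler_pdivrMl// -lee_fin fineK// -RintegralZl//.
rewrite /Rintegral fineK; last first.
  apply: integrable_fin_num => //.
  exact: (@integrableZl _ _ _ mu _ (measurable_itv _) (2 * Num.sqrt (2 * r))^-1 _ (iosc 0 t r)).
apply: (@le_trans _ _ (\int[mu]_(s in `[0%R, t]) osc_energy T (x s))%E).
  apply: ge0_le_integral => //.
  - by move=> s _; rewrite lee_fin mulr_ge0// invr_ge0 ltW.
  - apply/measurable_EFinP; apply: measurable_funTS; apply: measurable_funM => //.
    exact: (measurableT_comp (mosc r) mx).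
  - exact: measurable_funTS.
  - by move=> s _; exact: osc_window_energy.
apply: ge0_subset_integral => //.
- exact: measurable_funTS.
- by move=> s _; exact: osc_energy_ge0.
- by move=> s/=; rewrite !in_itv/=; lra.
Qed.

Let increment_error p q c B : -N <= p <= N -> -N <= q <= N ->
  (forall y, Num.min p q <= y <= Num.max p q -> `|h y - c| <= B) ->
  `|f q - f p - (q - p) * c| <= `|q - p| * B.
Proof.
wlog pq : p q / p <= q.
  move=> W pN qN; have [pq|qp] := leP p q => H.
    by apply: W => //; rewrite (min_l pq) (max_r pq).
  rewrite (_ : f q - f p - (q - p) * c = - (f p - f q - (p - q) * c)); last by ring.
  rewrite normrN [X in _ <= X * _]distrC; apply: W => //; first exact: ltW.
  by rewrite (min_l (ltW qp)) (max_r (ltW qp)).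
rewrite (min_l pq) (max_r pq) => pN qN H.
have ih : mu.-integrable `[p, q] (EFin \o h).
  apply: (@bounded_integrable_itv _ _ _ K); first exact: measurable_funTS.
  by move=> y yp; apply: hK; lra.
have icst (c' : R) : mu.-integrable `[p, q] (EFin \o (fun=> c')).
  by apply: (@bounded_integrable_itv _ _ _ `|c'|).
have cE (c' : R) : \int[mu]_(y in `[p, q]) c' = (q - p) * c'.
  rewrite Rintegral_cst//= lebesgue_measure_itv/= lte_fin mulrC.
  by case: ltgtP pq => // -> _; rewrite subrr.
rewrite fh// -cE -RintegralB//.
rewrite (ger0_norm (_ : 0 <= q - p)) ?subr_ge0// -cE.
apply: (le_trans (le_normr_Rintegral _ _)) => //.
  exact: (@integrableB _ _ _ mu _ (measurable_itv _) _ _ ih (icst c)).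
apply: le_Rintegral => //.
  apply: (@integrable_norm _ _ _ mu `[p, q]%classic (h \- cst c)).
  exact: (@integrableB _ _ _ mu _ (measurable_itv _) _ _ ih (icst c)).
Qed.

(** Both terms are averages over the cell: [f(x_b) - f(x_a)] is
    [(x_b - x_a)] times a mean of [h] over the values between [x_a] and [x_b], and each of
    these values is within [N (b - a)^alpha] of every [x_s] of the cell, as a segment
    stays in a ball that contains its ends. The factor [(b - a)^(alpha - 1)] bounds
    the slope. *)
Lemma chain_rule_cell a b : 0 <= a -> a < b -> b <= T ->
  `|f (x b) - f (x a) - (x b - x a) / (b - a) *
     (\int[mu]_(s in `[0, b]) Phi s - \int[mu]_(s in `[0, a]) Phi s)| <=
  N * (b - a) `^ (alpha - 1) *
    (\int[mu]_(s in `[0, b]) osc_window (x s) (b - a) -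
     \int[mu]_(s in `[0, a]) osc_window (x s) (b - a)).
Proof.
move=> a0 ab bT; rewrite !Rintegral_itv_diff ?(ltW ab)//.
set m := b - a; have m0 : 0 < m by rewrite subr_gt0.
have icst (c' : R) : mu.-integrable `[a, b] (EFin \o (fun=> c')).
  by apply: (@bounded_integrable_itv _ _ _ `|c'|).
have iZ (c' : R) (g : R -> R) : mu.-integrable `[a, b] (EFin \o g) ->
    mu.-integrable `[a, b] (EFin \o (fun s => c' * g s)).
  by move=> ig; exact: (@integrableZl _ _ _ mu _ (measurable_itv _) c' _ ig).
have E : m * (f (x b) - f (x a) - (x b - x a) / m * \int[mu]_(s in `[a, b]) Phi s) =
   \int[mu]_(s in `[a, b]) (f (x b) - f (x a) - (x b - x a) * Phi s).
  rewrite RintegralB//; last exact: iZ.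
  rewrite Rintegral_cst//= lebesgue_measure_itv/= lte_fin ab/= RintegralZl//.
  by rewrite -/m; field; rewrite gt_eqF.
rewrite -(ler_pM2l m0) -{1}(gtr0_norm m0) -normrM E.
have iD : mu.-integrable `[a, b] (EFin \o (fun s => f (x b) - f (x a) - (x b - x a) * Phi s)).
  exact: (@integrableB _ _ _ mu _ (measurable_itv _) _ _ (icst _) (iZ _ _ (iPhi a b))).
apply: (le_trans (le_normr_Rintegral _ iD)) => //.
have hm u v : a <= u <= b -> a <= v <= b -> `|x u - x v| <= N * m `^ alpha.
  move=> ub vb; apply: (le_trans (@hx v u _ _)); [lra|lra|].
  rewrite ler_wpM2l// ge0_ler_powR ?nnegrE ?(ltW m0)//; first by move: alphaP; lra.
  by rewrite /m ler_norml; lra.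
apply: (@le_trans _ _ (\int[mu]_(s in `[a, b]) (`|x b - x a| * osc_window (x s) m))).
  apply: le_Rintegral => //; [exact: (integrable_norm iD)|exact: iZ|].
  move=> s; rewrite /= in_itv/= => sab; apply: increment_error => //.
  move=> y yab; apply: h_osc => //.
    have := xN a; have := xN b; move: yab; rewrite /Num.min /Num.max; case: ifP; lra.
  have := hm a s; have := hm b s; rewrite !ler_norml.
  move: yab; rewrite /Num.min /Num.max; case: ifP => _; lra.
rewrite RintegralZl// !mulrA ler_wpM2r//.
  by apply: Rintegral_ge0 => s _; exact: osc_ge0.
have mm : m `^ (alpha - 1) * m = m `^ alpha.
  rewrite mulrC mulr_powRB1//; first exact: ltW.
  by move: alphaP; lra.
by rewrite -mulrA mulrCA [m * _]mulrC mm; apply: hm; lra.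
Qed.

(** Summing [chain_rule_cell] and using [integral_osc_window] at [r = mesh] bounds the
    error by a multiple of [mesh^(alpha - 1) * mesh^(1/2)]. *)
Lemma cvg_chain_rule t : 0 < t -> t <= T ->
  riemann_sum t x Phi n @[n --> \oo] --> f (x t) - f (x 0).
Proof.
move=> t0 tT; set M := fine (\int[mu]_(s in `[0%R, T]) osc_energy T (x s))%E.
have osc_sum n : `|riemann_sum t x Phi n - (f (x t) - f (x 0))| <=
    N * mesh t n `^ (alpha - 1) * \int[mu]_(s in `[0, t]) osc_window (x s) (mesh t n).
  have m0 := mesh_gt0 t0 n.
  have -> : f (x t) - f (x 0) =
      \sum_(0 <= i < n.+1) (f (x (node t n i.+1)) - f (x (node t n i))).
    by rewrite (telescope_sumr (fun i => f (x (node t n i))))// node0 node_last.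
  have -> : \int[mu]_(s in `[0, t]) osc_window (x s) (mesh t n) = \sum_(0 <= i < n.+1)
     (\int[mu]_(s in `[0, node t n i.+1]) osc_window (x s) (mesh t n) -
      \int[mu]_(s in `[0, node t n i]) osc_window (x s) (mesh t n)).
    rewrite (telescope_sumr (fun i => \int[mu]_(s in `[0, node t n i]) osc_window (x s) (mesh t n)))//.
    by rewrite node0 node_last set_itv1 Rintegral_set1 subr0.
  rewrite !big_mkord /riemann_sum -sumrB mulr_sumr.
  apply: (le_trans (ler_norm_sum _ _ _)); apply: ler_sum => i _.
  have mE' : node t n i.+1 - node t n i = mesh t n by rewrite nodeS addrAC subrr add0r.
  have := @chain_rule_cell (node t n i) (node t n i.+1).
  rewrite /slope mE' distrC; apply.
  - by have := node_itv t0 (ltnW (ltn_ord i)); lra.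
  - by rewrite nodeS; lra.
  - by have := node_itv t0 (ltn_ord i); lra.
have bound : \forall n \near \oo, `|riemann_sum t x Phi n - (f (x t) - f (x 0))| <=
    N * (2 * Num.sqrt 2) * M * mesh t n `^ (alpha - 2^-1).
  have : mesh t n `^ 1 @[n --> \oo] --> 0 by exact: cvg_mesh_powR.
  move=> /cvgrPdist_lt/(_ (T / 2)) [|n0 _ hn]; first by rewrite divr_gt0.
  (* [integral_osc_window] asks for twice the mesh to be at most [T] *)
  exists n0 => // n /= /hn; rewrite sub0r normrN powRr1; last exact: ltW (mesh_gt0 t0 n).
  rewrite (gtr0_norm (mesh_gt0 t0 n)) => mT; apply: (le_trans (osc_sum n)).
  have m0 := mesh_gt0 t0 n.
  apply: (@le_trans _ _ (N * mesh t n `^ (alpha - 1) * (2 * Num.sqrt (2 * mesh t n) * M))).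
    rewrite ler_wpM2l ?mulr_ge0 ?powR_ge0//; apply: integral_osc_window => //; lra.
  rewrite le_eqVlt; apply/orP; left; apply/eqP.
  rewrite sqrtrM// -[Num.sqrt (mesh t n)]powR12_sqrt ?(ltW m0)//.
  have -> : alpha - 2^-1 = (alpha - 1) + 2^-1 by field.
  by rewrite [X in _ = _ * X]powRD ?(gt_eqF m0) ?implybT//; ring.
set e := fun n => N * (2 * Num.sqrt 2) * M * mesh t n `^ (alpha - 2^-1).
have e0 : e n @[n --> \oo] --> 0.
  rewrite -(mulr0 (N * (2 * Num.sqrt 2) * M)); apply: cvgMl_tmp.
  by apply: cvg_mesh_powR => //; move: alphaP; lra.
set L := f (x t) - f (x 0).
apply: (@squeeze_cvgr _ _ _ _ (fun n => L - e n) (fun n => L + e n)).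
- by apply: filterS bound => n; rewrite -/(e n) -/L ler_norml; lra.
- by rewrite -[X in _ --> X]subr0; apply: cvgB => //; exact: cvg_cst.
- by rewrite -[X in _ --> X]addr0; apply: cvgD => //; exact: cvg_cst.
Qed.

(** The sums [riemann_sum] converge both to the pairing with [x] and to the increment of
    [f o x]. *)
Lemma gls_chain_rule t : 0 <= t <= T -> is_gls_integral T Phi x t (f (x t) - f (x 0)).
Proof.
move=> /andP[t0 tT].
have g1 : besov1 2^-1 T x by exact: (besov1_holder alphaP N0).
have g2 : besov2 2^-1 T Phi.
  by apply: (besov2_half T0 mPhi PhiK); exact: gagliardo_fin.
have [t0'|] := ltP 0 t.
  have hxt : holder_on alpha N t x by move=> s u st ut; apply: hx; lra.
  have [_ i1 i2] := cvg_riemann_sum alphaP N0 t0' hxt mPhi PhiK (gagliardo_fin tT) mx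
    (cvg_chain_rule t0' tT).
  exact: gls_integral_half.
move=> t0'; have -> : t = 0 by lra.
apply: gls_integral_half => //.
- by rewrite set_itv1 Rintegral_set1 subrr mulr0.
- rewrite set_itv1; apply/integrableP; split; first exact: measurable_fun_set1.
  by rewrite integral_set1 ltry.
Qed.
End chain_rule.

(** * Functions of locally bounded variation *)

Section local_variation.
Context {R : realType}.
Notation mu := (@lebesgue_measure R).
Implicit Types (N p q y z : R).

Definition clamp a b y : R := Num.max a (Num.min b y).

Lemma clamp_itv a b y : a <= b -> a <= clamp a b y <= b.
Proof. by move=> ab; rewrite /clamp /Num.max /Num.min; do 2 case: ifP; lra. Qed.

Lemma clamp_id a b y : a <= y <= b -> clamp a b y = y.
Proof. by move=> ab; rewrite /clamp /Num.max /Num.min; do 2 case: ifP; lra. Qed.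

Lemma clamp_nd a b : {homo clamp a b : y z / y <= z}.
Proof. by move=> y z; rewrite /clamp /Num.max /Num.min; do 4 case: ifP; lra. Qed.

Variable h : R -> R.
Hypothesis bv : locally_bounded_variation h.

(** Total variation counted from [- N], frozen outside [[- N, N]] so as to be bounded and
    nondecreasing on the whole line. *)
Definition local_tv N y : R := fine (total_variation (- N) (clamp (- N) N y) h).

Let tv_fin a b : a <= b -> total_variation a b h \is a fin_num.
Proof. by move=> ab; apply/bounded_variationP => //; exact: bv. Qed.

Lemma local_tv_increment N y z : - N <= y -> y <= z -> z <= N ->
  local_tv N z - local_tv N y = fine (total_variation y z h).
Proof.
move=> Ny yz zN; rewrite /local_tv !clamp_id; [|lra|lra].
rewrite (total_variationD h Ny yz) fineD ?tv_fin//; lra.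
Qed.

Lemma le_local_tv N y z : - N <= y -> y <= z -> z <= N ->
  `|h z - h y| <= local_tv N z - local_tv N y.
Proof.
move=> Ny yz zN; rewrite local_tv_increment// -lee_fin fineK ?tv_fin//.
exact: total_variation_ge.
Qed.

Lemma local_tv_nd N : 0 <= N -> nondecreasing_fun (local_tv N).
Proof.
move=> N0 y z yz; rewrite -subr_ge0.
have NN : - N <= N by lra.
have [ya yb] := andP (clamp_itv y NN); have [za zb] := andP (clamp_itv z NN).
have := @le_local_tv N (clamp (- N) N y) (clamp (- N) N z) ya (clamp_nd _ _ yz) zb.
rewrite /local_tv ![clamp _ _ (clamp _ _ _)]clamp_id ?clamp_itv//.
exact: le_trans.
Qed.

Lemma local_tv_bound N y : 0 <= N -> 0 <= local_tv N y <= local_tv N N.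
Proof.
move=> N0; have NN : - N <= N by lra.
have H z : local_tv N z = local_tv N (clamp (- N) N z).
  by rewrite /local_tv [clamp _ _ (clamp _ _ _)]clamp_id ?clamp_itv.
have L0 : local_tv N (- N) = 0.
  by rewrite /local_tv clamp_id ?total_variationxx//; lra.
have [ya yb] := andP (clamp_itv y NN); rewrite H -{1}L0.
by apply/andP; split; apply: local_tv_nd.
Qed.

Lemma bv_bounded N y : 0 <= N -> - N <= y <= N -> `|h y| <= `|h 0| + local_tv N N.
Proof.
move=> N0 yN; have := ler_normB (h y - h 0) (- h 0).
have -> : h y - h 0 - - h 0 = h y by ring.
rewrite normrN => /le_trans; apply; rewrite addrC lerD2l.
have b0 := local_tv_bound 0 N0; have by_ := local_tv_bound y N0.
have [y0|y0] := leP 0 y.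
  by apply: (le_trans (@le_local_tv N 0 y _ _ _)); lra.
by rewrite distrC; apply: (le_trans (@le_local_tv N y 0 _ _ _)); lra.
Qed.

(** Composed with the clamping to [[- n, n]], [h] is the difference of the nondecreasing
    functions [local_tv n] and [local_tv n - h]; and the clamping at [y] is the identity
    as soon as [n >= |y|]. *)
Lemma measurable_bv : measurable_fun setT h.
Proof.
pose c (n : nat) := clamp (- n%:R : R) n%:R.
have mc n : measurable_fun setT (h \o c n).
  have n0 : (0 : R) <= n%:R by [].
  have nn : - n%:R <= n%:R :> R by lra.
  have -> : h \o c n = (fun y => local_tv n%:R y - (local_tv n%:R y - h (c n y))).
    by apply/funext => y/=; ring.
  apply: measurable_funB.
    by apply: nondecreasing_measurable => //; exact: local_tv_nd.
  apply: nondecreasing_measurable => // y z yz.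
  have [ya yb] := andP (clamp_itv y nn); have [za zb] := andP (clamp_itv z nn).
  have := @le_local_tv n%:R (c n y) (c n z) ya (clamp_nd _ _ yz) zb.
  rewrite /local_tv ![clamp _ _ (c _ _)]clamp_id ?clamp_itv// -/(c n).
  rewrite ler_norml; lra.
apply: (@measurable_fun_cvg _ _ _ _ (fun n => h \o c n)) => // y _.
apply: cvg_near_cst.
exists (Num.truncn `|y|).+1 => // n /= yn.
rewrite /c clamp_id// -ler_norml; apply/ltW/(lt_le_trans (truncnS_gt _)).
by rewrite ler_nat.
Qed.

Lemma bv_integrable p q : mu.-integrable `[p, q] (EFin \o h).
Proof.
pose N := `|p| + `|q|; have N0 : 0 <= N by rewrite addr_ge0.
apply: (@bounded_integrable_itv _ _ _ (`|h 0| + local_tv N N)).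
  by apply: measurable_funTS; exact: measurable_bv.
move=> y pq; apply: bv_bounded => //.
have := ler_norm q; have := ler_norm (- p); rewrite normrN.
by have := normr_ge0 p; have := normr_ge0 q; rewrite /N; lra.
Qed.

Lemma oriented_integral_increment p q : p <= q ->
  oriented_integral h 0 q - oriented_integral h 0 p = \int[mu]_(y in `[p, q]) h y.
Proof.
move=> pq; rewrite /oriented_integral.
have [q0|q0] := leP 0 q; have [p0|p0] := leP 0 p.
- by rewrite Rintegral_itv_diff//; exact: bv_integrable.
- rewrite opprK -(@Rintegral_itv_diff _ h p 0 q) ?(ltW p0)//; last exact: bv_integrable.
  by rewrite subrK.
- lra.
- rewrite -(@Rintegral_itv_diff _ h p q 0) ?(ltW q0)//; last exact: bv_integrable.
  by ring.
Qed.

End local_variation.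

(** * Tonelli's theorem and joint measurability of Hölder processes *)

Section tonelli.
Context d1 d2 (T1 : measurableType d1) (T2 : measurableType d2) (R : realType).
Variables (m1 : {sigma_finite_measure set T1 -> \bar R})
  (m2 : {sigma_finite_measure set T2 -> \bar R}).
Variables (D : set T1) (k : T1 * T2 -> \bar R).
Hypotheses (mD : measurable D) (mk : measurable_fun setT k) (k0 : forall z, (0 <= k z)%E).

Let kD (z : T1 * T2) : \bar R := ((\1_D z.1)%:E * k z)%E.

Let mkD : measurable_fun setT kD.
Proof.
apply: emeasurable_funM => //; apply/measurable_EFinP.
have hi := @measurable_indic _ T1 R setT _ mD.
exact: (measurableT_comp hi measurable_fst).
Qed.

Let kD0 z : (0 <= kD z)%E. Proof. by rewrite mule_ge0. Qed.

Let kDE y : (\int[m1]_(x in D) k (x, y) = \int[m1]_x kD (x, y))%E.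
Proof.
apply: eq_integral_support => //= x Dx.
  by rewrite /kD/= indicE mem_set// mul1e.
by move=> nDx; rewrite /kD/= indicE memNset// mul0e.
Qed.

Lemma measurable_tonelli_on : measurable_fun setT (fun y => \int[m1]_(x in D) k (x, y))%E.
Proof.
by under eq_fun do rewrite kDE; apply: (measurable_fun_fubini_tonelli_G kD).
Qed.

Lemma tonelli_on :
  (\int[m2]_y \int[m1]_(x in D) k (x, y) = \int[m1]_(x in D) \int[m2]_y k (x, y))%E.
Proof.
under eq_integral do rewrite kDE.
rewrite -(@fubini_tonelli _ _ _ _ _ m1 m2 kD)//.
apply: eq_integral_support => //= x.
  move=> _ Dx; apply: eq_integral => y _; rewrite /kD/= indicE mem_set// mul1e//.
by move=> _ nDx; apply: integral0_eq => y _; rewrite /kD/= indicE memNset// mul0e.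
Qed.
End tonelli.

Lemma measurable_fun_countable_choice d (Omega : measurableType d) (R : realType)
    (I : countType) (N : Omega -> I) (F : I -> Omega -> R) :
  (forall i, measurable (N @^-1` [set i])) -> (forall i, measurable_fun setT (F i)) ->
  measurable_fun setT (fun w => F (N w) w).
Proof.
move=> mN mF _ B mB; rewrite setTI.
have -> : (fun w => F (N w) w) @^-1` B =
    \bigcup_i (N @^-1` [set i] `&` F i @^-1` B).
  by apply/seteqP; split => [w Bw|w [i _ [<-//]]]; exists (N w).
apply: countable_bigcupT_measurable => // i; apply: measurableI => //.
by rewrite -[X in measurable X]setTI; exact: mF.
Qed.

(** The process frozen at the grid times [floor(s n)/n] takes countably many forms, one on
    each cell, so it is jointly measurable; by Hölder continuity it converges to [Y]. *)
Lemma measurable_holder_process d (Omega : measurableType d) (R : realType) (g : R)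
    (Y : R -> Omega -> R) : 0 < g ->
  (forall s, measurable_fun setT (Y s)) ->
  (forall w, exists C, forall s u, `|Y u w - Y s w| <= C * `|u - s| `^ g) ->
  measurable_fun setT (fun z : measurableTypeR R * Omega => Y z.1 z.2).
Proof.
move=> g0 mY hY.
pose fl (n : nat) (s : R) : int := Num.floor (s * n.+1%:R).
pose Z n (z : measurableTypeR R * Omega) := Y ((fl n z.1)%:~R / n.+1%:R) z.2.
have fl_dist n s : `|(fl n s)%:~R / n.+1%:R - s| <= n.+1%:R^-1.
  have n0 : 0 < n.+1%:R :> R by [].
  have := floor_itv (s * n.+1%:R); rewrite intrD1 -/(fl n s) => /andP[f1 f2].
  have -> : (fl n s)%:~R / n.+1%:R - s = ((fl n s)%:~R - s * n.+1%:R) / n.+1%:R.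
    by field; rewrite gt_eqF.
  rewrite normrM (ger0_norm (_ : 0 <= n.+1%:R^-1)) ?invr_ge0//.
  by rewrite ler_piMl ?invr_ge0// ler_norml; lra.
have mZ n : measurable_fun setT (Z n).
  have ch := @measurable_fun_countable_choice _ (measurableTypeR R * Omega)%type R int
    (fun z => fl n z.1) (fun i z => Y (i%:~R / n.+1%:R) z.2).
  apply: ch.
  move=> i.
  have mfl : measurable_fun setT (fun s : measurableTypeR R => (fl n s)%:~R : measurableTypeR R).
    apply: nondecreasing_measurable => // s u su.
    by rewrite ler_int; apply: le_floor; rewrite ler_wpM2r.
  have := (measurableT_comp mfl (@measurable_fst _ _ (measurableTypeR R) Omega)) measurableT
     [set i%:~R] (measurable_set1 _).
  rewrite setTI; congr (measurable _); apply/seteqP; split=> z /=.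
    by move/(@intr_inj R).
  by move=> ->.
- move=> i; exact: (measurableT_comp (mY _) measurable_snd).
apply: (@measurable_fun_cvg _ _ _ _ Z) => // -[s w] _ /=; rewrite /Z/=.
have [C hC] := hY w; pose e n := `|C| * n.+1%:R^-1 `^ g.
have e0 : e n @[n --> \oo] --> 0.
  rewrite -(mulr0 `|C|); apply: cvgMl_tmp.
  apply: ((cvg_at_rightP _ _ _).1 (powR_cvg0 g0)); split => //.
  exact: cvg_harmonic.
apply: (@squeeze_cvgr _ _ _ _ (fun n => Y s w - e n) (fun n => Y s w + e n)).
- apply: nearW => n; have := hC s ((fl n s)%:~R / n.+1%:R).
  have : C * `|(fl n s)%:~R / n.+1%:R - s| `^ g <= e n.
    apply: (@le_trans _ _ (`|C| * `|(fl n s)%:~R / n.+1%:R - s| `^ g)).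
      by rewrite ler_wpM2r ?powR_ge0// ler_norm.
    by rewrite ler_wpM2l// ge0_ler_powR ?nnegrE ?invr_ge0 ?(ltW g0).
  by rewrite ler_norml; lra.
- by rewrite -[X in _ --> X]subr0; apply: cvgB => //; exact: cvg_cst.
- by rewrite -[X in _ --> X]addr0; apply: cvgD => //; exact: cvg_cst.
Qed.

Section holder_version.
Context d (Omega : measurableType d) (R : realType) (P : probability Omega R).
Implicit Types (s u : R).

Lemma clamp_dist (a b s u : R) : a <= b -> `|clamp a b u - clamp a b s| <= `|u - s|.
Proof.
move=> ab; rewrite /clamp /Num.max /Num.min.
do 4 (case: ifP); case: (ler0P (u - s)); rewrite ?ler_norml; lra.
Qed.

(** Clamping time to [[0, T]] extends the path to the line without increasing distances.
    On a bounded interval a Hölder condition implies those of smaller exponent, so the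
    exponent may be taken at most [1]. *)
Lemma holder_clamp (alpha T : R) (x : R -> R) : 0 < T -> 0 < alpha -> holder alpha T x ->
  exists2 C, 0 <= C & forall s u,
    `|x (clamp 0 T u) - x (clamp 0 T s)| <= C * `|u - s| `^ Num.min alpha 1.
Proof.
move=> T0 a0 [C hC]; set a := Num.min alpha 1.
have aa : 0 < a <= alpha by rewrite lt_min ge_min lexx a0 ltr01.
exists (`|C| * T `^ (alpha - a)); first by rewrite mulr_ge0 ?powR_ge0.
move=> s u; have ts := clamp_itv s (ltW T0); have tu := clamp_itv u (ltW T0).
apply: (le_trans (hC _ _ _ _)); rewrite ?in_itv//.
set D := `|clamp 0 T u - clamp 0 T s|.
have DT : D <= T by rewrite ler_norml; lra.
have Dus : D <= `|u - s| by apply: clamp_dist; exact: ltW.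
have D0 : 0 <= D by rewrite normr_ge0.
apply: (@le_trans _ _ (`|C| * D `^ alpha)); first by rewrite ler_wpM2r ?powR_ge0// ler_norm.
rewrite -mulrA ler_wpM2l//.
have [->|Dn0] := eqVneq D 0.
  by rewrite powR0 ?mulr_ge0 ?powR_ge0// gt_eqF.
have -> : D `^ alpha = D `^ (alpha - a) * D `^ a.
  by rewrite -powRD ?subrK// (negbTE Dn0) implybT.
by apply: ler_pM; rewrite ?powR_ge0// ge0_ler_powR ?nnegrE//; lra.
Qed.

(** The sample paths of [X] are known to be Hölder only outside some null set, and nothing
    relates them outside [[0, T]]. On a measurable null set containing the bad paths,
    [Y] is set to [0], and elsewhere time is clamped. *)
Lemma holder_version (alpha T : R) (X : R -> {RV P >-> R}) : 0 < T -> 0 < alpha ->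
  {ae P, forall w, holder alpha T (fun s => X s w)} ->
  exists Y : R -> Omega -> R,
  [/\ measurable_fun setT (fun z : measurableTypeR R * Omega => Y z.1 z.2),
      forall w, exists2 C, 0 <= C &
        forall s u, `|Y u w - Y s w| <= C * `|u - s| `^ Num.min alpha 1 &
      {ae P, forall w s, Y s w = X (clamp 0 T s) w}].
Proof.
move=> T0 a0 [A [mA PA HA]].
pose Y s w := \1_(~` A) w * X (clamp 0 T s) w.
have hY w : exists2 C, 0 <= C &
        forall s u, `|Y u w - Y s w| <= C * `|u - s| `^ Num.min alpha 1.
  have [Aw|nAw] := pselect (A w).
    exists 0 => // s u; rewrite /Y indicE memNset; last by move=> /(_ Aw).
    by rewrite !mul0r subrr normr0.
  have [C C0 hC] : exists2 C, 0 <= C & forall s u,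
      `|X (clamp 0 T u) w - X (clamp 0 T s) w| <= C * `|u - s| `^ Num.min alpha 1.
    by apply: (@holder_clamp alpha T (fun s => X s w)) => //; apply: contrapT => /HA.
  by exists C => // s u; rewrite /Y indicE mem_set// !mul1r.
exists Y; split => //.
- apply: (@measurable_holder_process _ _ _ (Num.min alpha 1)).
  + by rewrite lt_min a0 ltr01.
  + by move=> s; apply: measurable_funM => //; apply: measurable_indic; exact: measurableC.
  + by move=> w; have [C _ hC] := hY w; exists C.
- exists A; split => // w /= h; apply: contrapT => nAw; apply: h => s.
  by rewrite /Y indicE mem_set// mul1r.
Qed.
End holder_version.

(** * Expected oscillation of a monotone function along a process *)

Section expected_oscillation.
Context d (Omega : measurableType d) (R : realType) (P : probability Omega R).
Notation mu := (@lebesgue_measure R).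
Variables (U : Omega -> R) (G K : R) (V : R -> R).
Hypotheses (mU : measurable_fun setT U) (G0 : 0 <= G).
Hypothesis hU : forall a b, a <= b -> (P (U @^-1` `[a, b]) <= ((b - a) * G)%:E)%E.
Hypotheses (ndV : nondecreasing_fun V) (V0K : forall y, 0 <= V y <= K).

(** Layer-cake: the increment of [V] is the integral over the levels [l] in [[0, K]] of the
    indicator of [V(U - r) <= l < V(U + r)]. By monotonicity two points [z, z'] of the
    corresponding level set satisfy [|z - z'| < 2r]; the set lies in an interval of
    length [4r] around any of its points, which [U] visits with probability at most [4rG]. *)
Lemma expected_increment r : 0 <= r ->
  (\int[P]_w (V (U w + r) - V (U w - r))%:E <= (4 * r * G * K)%:E)%E.
Proof.
move=> r0; have K0 : 0 <= K by have := V0K 0; lra.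
have mV : measurable_fun setT V by exact: nondecreasing_measurable.
pose b (z : measurableTypeR R * Omega) := (V (U z.2 - r) <= z.1) && (z.1 < V (U z.2 + r)).
pose k (z : measurableTypeR R * Omega) : \bar R := if b z then 1%E else 0%E.
have mk : measurable_fun setT k.
  have mVc c : measurable_fun setT (fun z : measurableTypeR R * Omega => V (U z.2 + c)).
    apply: (measurableT_comp mV); apply: measurable_funD => //.
    exact: (measurableT_comp mU measurable_snd).
  apply: measurable_fun_ifT => //; apply: measurable_and.
    by apply: measurable_fun_ler; [exact: mVc|exact: measurable_fst].
  by apply: measurable_fun_ltr; [exact: measurable_fst|exact: mVc].
have k0 z : (0 <= k z)%E by rewrite /k; case: ifP.
have cake w : (\int[mu]_(l in `[0%R, K]) k (l, w) = (V (U w + r) - V (U w - r))%:E)%E.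
  have vv : V (U w - r) <= V (U w + r) by apply: ndV; lra.
  have := V0K (U w - r); have := V0K (U w + r) => v1 v2.
  transitivity (\int[mu]_(l in `[V (U w - r), V (U w + r)[) 1)%E.
    apply: eq_integral_support => l /=; rewrite !in_itv/= /k /b/=.
    - by move=> _ ->.
    - by move=> _ /negP/negbTE ->.
    - by move=> h1 h2; exfalso; apply: h2; lra.
  rewrite integral_cst//= mul1e lebesgue_measure_itv/= lte_fin.
  by case: ltgtP vv => // -> _; rewrite subrr.
under eq_integral do rewrite -cake.
rewrite (@tonelli_on _ _ (measurableTypeR R) Omega R mu P `[0, K]%classic k)//.
apply: (@le_trans _ _ (\int[mu]_(l in `[0%R, K]) (4 * r * G)%:E)%E); last first.
  rewrite integral_cst//= lebesgue_measure_itv/= lte_fin.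
  by case: ltP => _; [rewrite -EFinD subr0 -EFinM|rewrite mule0 lee_fin !mulr_ge0].
have mkP : measurable_fun setT (fun l : measurableTypeR R => \int[P]_w k (l, w))%E.
  exact: (measurable_fun_fubini_tonelli_F k).
apply: ge0_le_integral => //.
- by move=> l _; exact: integral_ge0.
- exact: measurable_funTS.
move=> l _.
have [[w0 bw0]|nb] := pselect (exists w, b (l, w)); last first.
  rewrite integral0_eq ?lee_fin ?mulr_ge0// => w _; rewrite /k ifF//.
  by apply/negP => bw; apply: nb; exists w.
apply: (@le_trans _ _ (P (U @^-1` `[U w0 - 2 * r, U w0 + 2 * r]))); last first.
  apply: (le_trans (hU _)); first lra.
  by rewrite lee_fin le_eqVlt; apply/orP; left; apply/eqP; ring.
have mS : measurable (U @^-1` `[U w0 - 2 * r, U w0 + 2 * r]).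
  by rewrite -[X in measurable X]setTI; exact: mU.
rewrite -(setIT (U @^-1` _)) -integral_indic//.
apply: ge0_le_integral => //.
- by apply: (measurableT_comp mk); exact: (pair1_measurable (l : measurableTypeR R)).
- by apply/measurable_EFinP; exact: measurable_indic.
move=> w _; rewrite /k; case: ifP => // /andP[/= b1 b2]; move: bw0 => /andP[/= c1 c2].
rewrite indicE mem_set ?lexx//= in_itv/=.
have s1 : U w - r < U w0 + r by apply: contraTT (le_lt_trans b1 c2); rewrite -!leNgt; exact: ndV.
have s2 : U w0 - r < U w + r by apply: contraTT (le_lt_trans c1 b2); rewrite -!leNgt; exact: ndV.
lra.
Qed.

Variables (alpha N : R).
Hypotheses (alphaP : 2^-1 < alpha <= 1) (N0 : 0 <= N).

(** By Tonelli's theorem and [expected_increment] at [N r^alpha], the expectation is at most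
    a multiple of the integral of [r^alpha r^(-3/2)], which converges since [alpha > 1/2]. *)
Lemma expected_osc_energy T : 0 <= T ->
  (\int[P]_w osc_energy alpha N V T (U w) <=
   (4 * N * G * K * (T `^ (alpha - 2^-1) / (alpha - 2^-1)))%:E)%E.
Proof.
move=> T0; have K0 : 0 <= K by have := V0K 0; lra.
have osc0 y r : 0 <= osc_window alpha N V y r.
  rewrite subr_ge0; apply: ndV.
  have : 0 <= N * r `^ alpha by rewrite mulr_ge0 ?powR_ge0.
  lra.
pose k (z : measurableTypeR R * Omega) : \bar R := (osc_window alpha N V (U z.2) z.1 * rm32 z.1)%:E.
have mk : measurable_fun setT k.
  apply/measurable_EFinP; apply: measurable_funM.
    have mp : measurable_fun setT (fun z : measurableTypeR R * Omega =>
        (U z.2 : measurableTypeR R, z.1)).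
      apply/measurable_fun_pairP; split; [|exact: measurable_fst].
      exact: (measurableT_comp mU measurable_snd).
    exact: (measurableT_comp (measurable_osc2 alpha N ndV) mp).
  exact: (measurableT_comp (@measurable_rm32 _ setT) measurable_fst).
have k0 z : (0 <= k z)%E by rewrite lee_fin mulr_ge0 ?rm32_ge0.
rewrite [leLHS](@tonelli_on _ _ (measurableTypeR R) Omega R mu P `[0, T]%classic k)//.
apply: (@le_trans _ _ (\int[mu]_(r in `[0%R, T])
    (4 * N * G * K * (`|r - 0| `^ alpha * rm32 (r - 0)))%:E)%E); last first.
  under eq_integral do rewrite EFinM.
  rewrite ge0_integralZl//.
  - by rewrite integral_holder_rm32// subr0 -EFinM.
  - apply/measurable_EFinP; apply: measurable_funTS; apply: measurable_funM.
      apply: (measurableT_comp (measurable_powR alpha)).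
      by apply: measurableT_comp => //; exact: measurable_funB.
    by apply: (measurableT_comp (@measurable_rm32 _ setT)); exact: measurable_funB.
  - by move=> u _; rewrite lee_fin mulr_ge0 ?powR_ge0 ?rm32_ge0.
  - by rewrite lee_fin !mulr_ge0.
have mkP : measurable_fun setT (fun l : measurableTypeR R => \int[P]_w k (l, w))%E.
  exact: (measurable_fun_fubini_tonelli_F k).
apply: ge0_le_integral => //.
- by move=> l _; exact: integral_ge0.
- exact: measurable_funTS.
- apply/measurable_EFinP; apply: measurable_funTS; apply: measurable_funM => //.
  apply: measurable_funM.
    apply: (measurableT_comp (measurable_powR alpha)).
    by apply: measurableT_comp => //; exact: measurable_funB.
  by apply: (measurableT_comp (@measurable_rm32 _ setT)); exact: measurable_funB.
move=> r; rewrite /= in_itv/= => /andP[r0 _]; rewrite subr0 ger0_norm//.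
under eq_integral do rewrite /k/= mulrC EFinM.
rewrite ge0_integralZl//; last 3 first.
- have mp := measurableT_comp (measurable_osc2 alpha N ndV) (pair2_measurable r).
  by apply/measurable_EFinP; exact: (measurableT_comp mp mU).
- by move=> w _; rewrite lee_fin.
- by rewrite lee_fin rm32_ge0.
rewrite mulrA EFinM muleC; apply: lee_wpmul2r; first by rewrite lee_fin rm32_ge0.
rewrite (_ : 4 * N * G * K * r `^ alpha = 4 * (N * r `^ alpha) * G * K); last by ring.
by apply: expected_increment; rewrite mulr_ge0 ?powR_ge0.
Qed.
End expected_oscillation.

Section oscillation_of_process.
Context d (Omega : measurableType d) (R : realType) (P : probability Omega R).
Notation mu := (@lebesgue_measure R).

Lemma density_small_ball (U : {RV P >-> R}) (p : R -> R) (G : R) : is_density U p ->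
  (ereal_sup (range (fun y => (p y)%:E)) <= G%:E)%E ->
  0 <= G /\ forall a b, a <= b -> (P (U @^-1` `[a, b]) <= ((b - a) * G)%:E)%E.
Proof.
move=> [mp p0 dp] supG.
have pG y : p y <= G.
  by rewrite -lee_fin (le_trans _ supG)//; apply: ereal_sup_ubound; exists y.
split=> [|a b ab]; first exact: le_trans (p0 0) (pG 0).
have -> : P (U @^-1` `[a, b]) = distribution P U `[a, b]%classic by [].
rewrite dp//; apply: (@le_trans _ _ (\int[mu]_(y in `[a, b]) G%:E)%E).
  apply: ge0_le_integral => //.
  - by move=> y _; rewrite lee_fin.
  - by apply/measurable_EFinP; exact: measurable_funTS.
  - by move=> y _; rewrite lee_fin.
rewrite integral_cst//= lebesgue_measure_itv/= lte_fin.
case: ltgtP ab => // [ab|->] _; first by rewrite -EFinD -EFinM mulrC.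
by rewrite mule0 subrr mul0r.
Qed.

(** The expectation of the integral over [s] is at most a multiple of the integral of the
    bound [g] on the densities. *)
Lemma ae_osc_energy_lty (alpha T N K : R) (V : R -> R) (X : R -> {RV P >-> R})
    (Y : R -> Omega -> R) : 2^-1 < alpha <= 1 -> 0 <= N -> 0 < T ->
  nondecreasing_fun V -> (forall y, 0 <= V y <= K) -> assumption_D T X ->
  measurable_fun setT (fun z : measurableTypeR R * Omega => Y z.1 z.2) ->
  {ae P, forall w s, Y s w = X (clamp 0 T s) w} ->
  {ae P, forall w, (\int[mu]_(s in `[0%R, T]) osc_energy alpha N V T (Y s w) < +oo)%E}.
Proof.
move=> alphaP N0 T0 ndV V0K [p [dp [g ig supg]]] mY [A [mA PA AY]].
pose k (z : measurableTypeR R * Omega) := osc_energy alpha N V T (Y z.1 z.2).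
have mk : measurable_fun setT k.
  exact: (measurableT_comp (measurable_osc_energy alpha N0 ndV T) mY).
have k0 z : (0 <= k z)%E by exact: osc_energy_ge0.
have mYs s : measurable_fun setT (Y s).
  exact: (measurableT_comp mY (pair1_measurable (s : measurableTypeR R))).
pose C := 4 * N * K * (T `^ (alpha - 2^-1) / (alpha - 2^-1)).
have mi := @measurable_tonelli_on _ _ (measurableTypeR R) Omega R mu `[0, T]%classic k
  (measurable_itv _) mk k0.
have fin : (\int[P]_w \int[mu]_(s in `[0%R, T]) k (s, w) < +oo)%E.
  rewrite (@tonelli_on _ _ (measurableTypeR R) Omega R mu P `[0, T]%classic k)//.
  apply: (@le_lt_trans _ _ (\int[mu]_(s in `[0%R, T]) `|(C * g s)%:E|)%E); last first.
    have := @integrableZl _ _ _ mu _ (measurable_itv _) C _ ig.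
    by move/integrableP => [].
  apply: ae_ge0_le_integral => //.
  - by move=> s _; exact: integral_ge0.
  - by apply: measurable_funTS; exact: (measurable_fun_fubini_tonelli_F k).
  - apply: measurableT_comp => //; apply/measurable_EFinP; apply: measurable_funM => //.
    exact: ((measurable_EFinP _ _).1 (measurable_int mu ig)).
  have aef : Filter (almost_everywhere mu) by exact: ae_filter_ringOfSetsType.
  apply: filterS (filterI dp supg) => s [dps supgs] sT.
  have sT' : s \in `[0, T] by [].
  have [g0 conc] := density_small_ball (dps sT') (supgs sT').
  apply: (@le_trans _ _ (C * g s)%:E); last by rewrite lee_fin ler_norm.
  rewrite (_ : C * g s = 4 * N * g s * K * (T `^ (alpha - 2^-1) / (alpha - 2^-1))); last first.
    by rewrite /C; ring.
  apply: (@expected_osc_energy _ _ _ P (Y s) (g s) K V) => //; last exact: ltW.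
  move=> a b ab; apply: (le_trans _ (conc a b ab)).
  have mX : measurable (X s @^-1` `[a, b]).
    by rewrite -[X in measurable X]setTI; exact: measurable_funP.
  rewrite -[leRHS]adde0 -PA.
  apply: (le_trans _ (measureU2 _ _ _)) => //.
  apply: le_measure; rewrite ?inE//.
  - by rewrite -[X in measurable X]setTI; exact: mYs.
  - exact: measurableU.
  move=> w /= Yw; have [Aw|nAw] := pselect (A w); [by right|left => /=].
  have : forall s, Y s w = X (clamp 0 T s) w by apply: contrapT => /AY.
  by move=> /(_ s); rewrite clamp_id => [<-//|]; rewrite in_itv/= in sT'.
have i : P.-integrable setT (fun w => \int[mu]_(s in `[0%R, T]) k (s, w))%E.
  apply/integrableP; split => //.
  under eq_integral do rewrite gee0_abs ?integral_ge0//.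
  exact: fin.
have := integrable_ae measurableT i.
apply: filterS => w /(_ I); rewrite ge0_fin_numE//; exact: integral_ge0.
Qed.
End oscillation_of_process.

(** * The change of variables formula *)

Section gls_restriction.
Context {R : realType}.
Notation mu := (@lebesgue_measure R).

(** The Besov norms and the fractional derivatives see only the values on [[0, T]]. *)
Lemma eq_is_gls_integral (T : R) (phi phi' x x' : R -> R) t v :
  (forall s, 0 <= s <= T -> phi s = phi' s) -> (forall s, 0 <= s <= T -> x s = x' s) ->
  0 <= t <= T -> is_gls_integral T phi x t v -> is_gls_integral T phi' x' t v.
Proof.
move=> ep ex tT [beta beta01 [[mp np] [mx nx] ->]].
exists beta; [exact: beta01|split].
- split.
    by apply: eq_measurable_fun mp => s; rewrite inE/= in_itv/=; exact: ep.
  suff -> : besov2_norm beta T phi' = besov2_norm beta T phi by exact: np.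
  rewrite /besov2_norm; congr (_ + _)%E.
    by apply: eq_integral => s; rewrite inE/= in_itv/= => sT; rewrite ep.
  apply: eq_integral => s; rewrite inE/= in_itv/= => sT.
  by apply: eq_integral => u; rewrite inE/= in_itv/= => us; rewrite !ep//; lra.
- split.
    by apply: eq_measurable_fun mx => s; rewrite inE/= in_itv/=; exact: ex.
  suff -> : besov1_norm (1 - beta) T x' = besov1_norm (1 - beta) T x by exact: nx.
  rewrite /besov1_norm; congr ereal_sup.
  apply: eq_imagel => -[s u]/= [s0 [su uT]].
  rewrite !ex; [|lra|lra]; congr (_ + _)%E.
  by apply: eq_integral => y; rewrite inE/= in_itv/= => ys; rewrite !ex//; lra.
congr (- _); apply: eq_Rintegral => s; rewrite inE/= in_itv/= => st.
rewrite /frac_deriv_left /frac_deriv_right !ep ?ex; [|lra..].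
congr (_ * (_ + _ * _) * (_ * (_ + _ * _))); apply: eq_Rintegral => u;
  rewrite inE/= in_itv/= => us; [rewrite ep//|rewrite ex//]; lra.
Qed.
End gls_restriction.

Unset Implicit Arguments.

Theorem theorem3p7 (R : realType) (d : measure_display)
    (Omega : measurableType d) (P : probability Omega R)
    (T : R) (hT : 0 < T) (X : R -> {RV P >-> R})
    (alpha : R) (halpha : 1 / 2 < alpha)
    (hX : {ae P, forall w, holder alpha T (fun s => X s w)})
    (hD : assumption_D T X)
    (f : R -> R) (hf : left_derivable f)
    (hBV : locally_bounded_variation (left_derivative f))
    (hint : forall x, f x = oriented_integral (left_derivative f) 0 x)
    (t : R) (ht : t \in `[0, T]) :
  {ae P, forall w, exists2 I : R,
     is_gls_integral T (fun s => left_derivative f (X s w))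
       (fun s => X s w) t I &
     f (X t w) = f (X 0 w) + I}.
Proof.
set h := left_derivative f in hBV hint *.
have alpha0 : 0 < alpha by lra.
set a := Num.min alpha 1.
have aP : 2^-1 < a <= 1 by rewrite /a /Num.min; case: ifP; lra.
have [Y [mY hY YX]] := holder_version hT alpha0 hX.
have energy n : {ae P, forall w, (\int[lebesgue_measure]_(s in `[0%R, T])
    osc_energy a n%:R (local_tv h n%:R) T (Y s w) < +oo)%E}.
  apply: ae_osc_energy_lty aP _ hT _ _ hD mY YX => //; first exact: local_tv_nd.
  by move=> y; exact: local_tv_bound.
have := ae_foralln energy; apply: filterS2 YX => w YX {}energy.
have [C C0 hC] := hY w.
have tT : 0 <= t <= T by rewrite in_itv/= in ht.
(* one integer serves as Hölder constant and as bound of the path; energies were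
   controlled for every integer at once, so it may depend on the path *)
have [n nC] : exists n : nat, C + `|Y 0 w| + C * T `^ a <= n%:R.
  by exists (Num.truncn (C + `|Y 0 w| + C * T `^ a)).+1; apply/ltW/truncnS_gt.
have CT0 : 0 <= C * T `^ a by rewrite mulr_ge0 ?powR_ge0.
have YN s : - n%:R <= Y s w <= n%:R.
  rewrite -ler_norml YX -[clamp 0 T s](@clamp_id _ 0 T) ?clamp_itv ?(ltW hT)// -YX.
  have cs := clamp_itv s (ltW hT).
  have := hC 0 (clamp 0 T s); rewrite subr0 (ger0_norm (_ : 0 <= clamp 0 T s)); last lra.
  have : C * clamp 0 T s `^ a <= C * T `^ a.
    by rewrite ler_wpM2l// ge0_ler_powR ?nnegrE//; lra.
  have := ler_normD (Y (clamp 0 T s) w - Y 0 w) (Y 0 w); rewrite subrK.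
  by rewrite /= -/a; lra.
have mYw : measurable_fun setT (Y ^~ w).
  exact: (measurableT_comp mY (pair2_measurable w)).
have Yholder : holder_on a n%:R T (Y ^~ w).
  move=> s u _ _; apply: (le_trans (hC s u)); rewrite ler_wpM2r ?powR_ge0//.
  by have := normr_ge0 (Y 0 w); lra.
have fh p q : p <= q -> f q - f p = \int[lebesgue_measure]_(y in `[p, q]) h y.
  by move=> pq; rewrite !hint oriented_integral_increment.
have n0 : (0 : R) <= n%:R := ler0n R n.
have V0K y : 0 <= local_tv h n%:R y <= `|h 0| + local_tv h n%:R n%:R.
  have [-> /= L] := andP (local_tv_bound hBV y n0).
  by rewrite (le_trans L)// lerDr.
have hh y z : - n%:R <= y -> y <= z -> z <= n%:R ->
    `|h z - h y| <= local_tv h n%:R z - local_tv h n%:R y.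
  exact: le_local_tv.
have hb y : - n%:R <= y <= n%:R -> `|h y| <= `|h 0| + local_tv h n%:R n%:R.
  exact: bv_bounded.
have Z := gls_chain_rule aP n0 (local_tv_nd hBV n0) V0K (measurable_bv hBV) hb hh fh hT
  mYw Yholder YN (energy n) tT.
have XY s : 0 <= s <= T -> Y s w = X s w by move=> sT; rewrite YX clamp_id.
exists (f (X t w) - f (X 0 w)); last by rewrite addrC subrK.
rewrite -(XY t tT) -(XY 0); last by rewrite lexx (ltW hT).
by apply: eq_is_gls_integral Z => // s sT; rewrite XY.
Qed.
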